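(* Let $\mathcal X,\mathcal Z$ be complex Hilbert spaces and let $(E,AQ)$ be a port-Hamiltonian differential-algebraic equation (pH-DAE), where $E,Q\in L(\mathcal X,\mathcal Z)$ and $A\colon\mathcal D(A)\subseteq\mathcal Z\to\mathcal Z$. Assume that there exists $\omega>0$ with $\mathbb C_{\mathrm{Re}>\omega}\subseteq\rho(E,AQ)$, let $p=p_{\mathrm{c,res}}^{(E,AQ)}$ be the complex resolvent index of $(E,AQ)$, and let $\mu\in\rho(E,AQ)$. Then for every $x_0\in\operatorname{ran}\big(((\mu E-AQ)^{-1}E)^{p+2}\big)$ there exists a unique classical solution $x\colon\mathbb R_{\ge0}\to\mathcal X$ of $$\frac{d}{dt}Ex(t)=AQx(t),\quad t\ge0,\qquad x(0)=x_0.$$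
   Context: $L(\mathcal X,\mathcal Z)$ denotes bounded linear operators; $\mathbb N=\{0,1,2,\dots\}$; $\mathbb C_{\mathrm{Re}>\omega}=\{\lambda\in\mathbb C:\operatorname{Re}\lambda>\omega\}$. $(E,AQ)$ is a pH-DAE if: $E,Q\in L(\mathcal X,\mathcal Z)$; $A\colon\mathcal D(A)\subseteq\mathcal Z\to\mathcal Z$ is closed, densely defined and dissipative ($\operatorname{Re}\langle Az,z\rangle\le0$ for all $z\in\mathcal D(A)$); $\operatorname{ran}E$ is closed; $Q$ is (boundedly) invertible; and $E^*Q=Q^*E\ge0$, i.e. $\langle E^*Qx,x\rangle\ge0$ for all $x\in\mathcal X$. The domain of $AQ$ is $\mathcal D(AQ)=\{x\in\mathcal X:Qx\in\mathcal D(A)\}$. $\rho(E,AQ)=\{\lambda\in\mathbb C:(\lambda E-AQ)^{-1}\in L(\mathcal Z,\mathcal X)\}$. The complex resolvent index $p_{\mathrm{c,res}}^{(E,AQ)}$ is the smallest $p\in\mathbb N$ such that there exist $\omega'\in\mathbb R$, $C>0$ with $\mathbb C_{\mathrm{Re}>\omega'}\subseteq\rho(E,AQ)$ and $\|(\lambda E-AQ)^{-1}\|\le C|\lambda|^{p-1}$ for all $\lambda\in\mathbb C_{\mathrm{Re}>\omega'}$; under the stated hypotheses it exists (and is at most $3$). Classical solution: $x$ is continuous on $\mathbb R_{\ge0}$, $Ex(\cdot)$ is continuously differentiable on $\mathbb R_{>0}$, $x(t)\in\mathcal D(AQ)$ for all $t\ge0$, $x(0)=x_0$, and $\frac{d}{dt}Ex(t)=AQx(t)$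 holds for $t\ge0$ (derivative at $t=0$ one-sided). *)

(* Defs.v *)
From Stdlib Require Import Reals ZArith.
From Coquelicot Require Import Coquelicot.
Set Implicit Arguments.
Unset Strict Implicit.
Unset Printing Implicit Defensive.

Local Open Scope R_scope.

(** * Complex Hilbert spaces *)

(* The inner product is linear in its first argument. Positive definiteness
   follows from [inner_norm] and [norm_eq_zero]. *)
Record HilbertSpace : Type := {
  carrier :> CompleteNormedModule C_AbsRing;
  inner : carrier -> carrier -> C;
  inner_plus_l : forall x y z : carrier,
    inner (plus x y) z = (inner x z + inner y z)%C;
  inner_scal_l : forall (a : C) (x z : carrier),
    inner (scal a x) z = (a * inner x z)%C;
  inner_conj : forall x y : carrier, inner y x = Cconj (inner x y);
  inner_norm : forall x : carrier, inner x x = RtoC (norm x ^ 2)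
}.

(** * A complex normed space as a real one

   Differentiation with respect to a real variable requires a normed module
   over [R_AbsRing]; the uniform structure and the norm are unchanged. *)
Section RestrictScalars.

Variable V : NormedModule C_AbsRing.

Definition rscal (a : R) (v : V) : V := scal (RtoC a : C_AbsRing) v.

Fact rscal_assoc (a b : R) (v : V) :
  rscal a (rscal b v) = rscal (@mult R_AbsRing a b) v.
Proof.
  unfold rscal; rewrite scal_assoc; f_equal.
  symmetry; exact (RtoC_mult a b).
Qed.

Fact rscal_one (v : V) : rscal (@one R_AbsRing) v = v.
Proof. exact (scal_one v). Qed.

Fact rscal_distr_l (a : R) (u v : V) :
  rscal a (plus u v) = plus (rscal a u) (rscal a v).
Proof. exact (scal_distr_l (RtoC a : C_AbsRing) u v). Qed.

Fact rscal_distr_r (a b : R) (v : V) :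
  rscal (@plus R_AbsRing a b) v = plus (rscal a v) (rscal b v).
Proof.
  refine (eq_trans _ (scal_distr_r (RtoC a : C_AbsRing) (RtoC b) v)).
  unfold rscal; f_equal; exact (RtoC_plus a b).
Qed.

Definition real_ModuleSpace_mixin :=
  ModuleSpace.Mixin R_AbsRing _ rscal
    rscal_assoc rscal_one rscal_distr_l rscal_distr_r.

Definition real_NormedModuleAux : NormedModuleAux R_AbsRing :=
  NormedModuleAux.Pack R_AbsRing V
    (NormedModuleAux.Class R_AbsRing V
       (ModuleSpace.Class R_AbsRing V _ real_ModuleSpace_mixin)
       (UniformSpace.class V))
    V.

Fact norm_rscal (a : R) (v : V) :
  norm (rscal a v) <= @abs R_AbsRing a * norm v.
Proof.
  apply Rle_trans with (1 := norm_scal (RtoC a : C_AbsRing) v).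
  apply Req_le; f_equal.
  exact (Cmod_R a).
Qed.

Definition real_NormedModule_mixin :
    NormedModule.mixin_of R_AbsRing real_NormedModuleAux :=
  NormedModule.Mixin R_AbsRing real_NormedModuleAux
    (@norm C_AbsRing V) (@norm_factor C_AbsRing V)
    (@norm_triangle C_AbsRing V) norm_rscal
    (@norm_compat1 C_AbsRing V) (@norm_compat2 C_AbsRing V)
    (@norm_eq_zero C_AbsRing V).

Definition real_NormedModule : NormedModule R_AbsRing :=
  NormedModule.Pack R_AbsRing V
    (NormedModule.Class R_AbsRing V
       (NormedModuleAux.class R_AbsRing real_NormedModuleAux)
       real_NormedModule_mixin)
    V.

End RestrictScalars.

(** * Operators

   Coquelicot's [is_linear] includes boundedness, so that [is_linear T] says
   that [T] belongs to L(U, V). *)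

(* A partially defined operator; the values of [app] outside [dom] are
   irrelevant. *)
Record partial_op (U V : NormedModule C_AbsRing) : Type := PartialOp {
  dom : U -> Prop;
  app :> U -> V
}.

Definition linear_op (U V : NormedModule C_AbsRing) (T : partial_op U V) : Prop :=
  dom T zero /\
  (forall x y : U, dom T x -> dom T y ->
     dom T (plus x y) /\ T (plus x y) = plus (T x) (T y)) /\
  (forall (a : C) (x : U), dom T x ->
     dom T (scal a x) /\ T (scal a x) = scal a (T x)).

Definition closed_op (U V : NormedModule C_AbsRing) (T : partial_op U V) : Prop :=
  @closed (prod_UniformSpace U V)
    (fun q : U * V => dom T (fst q) /\ T (fst q) = snd q).

Definition densely_defined (U V : NormedModule C_AbsRing)
    (T : partial_op U V) : Prop :=
  forall (x : U) (eps : posreal), exists y : U, dom T y /\ ball x eps y.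

Definition dissipative (Z : HilbertSpace) (A : partial_op Z Z) : Prop :=
  forall z : Z, dom A z -> Re (inner (A z) z) <= 0.

Definition comp_op (U V W : NormedModule C_AbsRing) (A : partial_op V W)
    (Q : U -> V) : partial_op U W :=
  PartialOp (fun x => dom A (Q x)) (fun x => A (Q x)).

Definition pencil (U V : NormedModule C_AbsRing) (E : U -> V)
    (B : partial_op U V) (lambda : C) : partial_op U V :=
  PartialOp (dom B) (fun x => minus (scal lambda (E x)) (B x)).

(* [S] is the inverse of [T], and it belongs to L(V, U). *)
Definition bounded_inverse (U V : NormedModule C_AbsRing) (T : partial_op U V)
    (S : V -> U) : Prop :=
  is_linear S /\
  (forall z : V, dom T (S z) /\ T (S z) = z) /\
  (forall x : U, dom T x -> S (T x) = x).

Definition op_norm (U V : NormedModule C_AbsRing) (T : U -> V) : Rbar :=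
  Lub_Rbar (fun r => exists x : U, norm x <= 1 /\ r = norm (T x)).

Definition is_adjoint (X Z : HilbertSpace) (T : X -> Z) (Ts : Z -> X) : Prop :=
  is_linear Ts /\ forall (x : X) (z : Z), inner (T x) z = inner x (Ts z).

(** * Resolvent set and complex resolvent index of (E, B) *)

Definition is_resolvent (U V : NormedModule C_AbsRing) (E : U -> V)
    (B : partial_op U V) (lambda : C) (S : V -> U) : Prop :=
  bounded_inverse (pencil E B lambda) S.

Definition resolvent_set (U V : NormedModule C_AbsRing) (E : U -> V)
    (B : partial_op U V) (lambda : C) : Prop :=
  exists S : V -> U, is_resolvent E B lambda S.

(* The exponent [p - 1] is an integer, equal to [-1] for [p = 0]. The value
   of [powerRZ 0 _] does not matter, because [omega] may be enlarged. *)
Definition resolvent_growth (U V : NormedModule C_AbsRing) (E : U -> V)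
    (B : partial_op U V) (p : nat) : Prop :=
  exists omega M : R, 0 < M /\
    forall lambda : C, omega < Re lambda ->
      resolvent_set E B lambda /\
      forall S : V -> U, is_resolvent E B lambda S ->
        Rbar_le (op_norm S) (M * powerRZ (Cmod lambda) (Z.of_nat p - 1)).

Definition is_complex_resolvent_index (U V : NormedModule C_AbsRing)
    (E : U -> V) (B : partial_op U V) (p : nat) : Prop :=
  resolvent_growth E B p /\
  forall q : nat, resolvent_growth E B q -> (p <= q)%nat.

(** * Port-Hamiltonian differential-algebraic equations *)

Record pH_DAE (X Z : HilbertSpace) (E : X -> Z) (A : partial_op Z Z)
    (Q : X -> Z) : Prop := {
  pH_E_bounded : is_linear E;
  pH_Q_bounded : is_linear Q;
  pH_A_linear : linear_op A;
  pH_A_closed : closed_op A;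
  pH_A_dense : densely_defined A;
  pH_A_dissipative : dissipative A;
  pH_E_closed_range : closed (fun z : Z => exists x : X, E x = z);
  pH_Q_invertible :
    exists Qi : Z -> X, bounded_inverse (PartialOp (fun _ => True) Q) Qi;
  pH_EQ : exists Es Qs : Z -> X,
    is_adjoint E Es /\ is_adjoint Q Qs /\
    (forall x : X, Es (Q x) = Qs (E x)) /\
    (forall x : X, Im (inner (Es (Q x)) x) = 0 /\ 0 <= Re (inner (Es (Q x)) x))
}.

(** * Classical solutions

   A function on the half-line is a function on [R] of which only the values
   at [t >= 0] are used. *)

(* Derivative of [f] relative to [0, +oo): one-sided at [t = 0]. *)
Definition is_derive_halfline (V : NormedModule C_AbsRing) (f : R -> V) (t : R)
    (l : V) : Prop :=
  @filterdiff R_AbsRing R_NormedModule (real_NormedModule V) f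
    (within (fun s => 0 <= s) (locally t))
    (fun h => @scal _ (real_NormedModule V) h l).

Definition classical_solution (U V : NormedModule C_AbsRing) (E : U -> V)
    (B : partial_op U V) (x0 : U) (x : R -> U) : Prop :=
  continuous_on (fun t : R => 0 <= t) x /\
  (exists d : R -> V,
     (forall t : R, 0 < t ->
        @is_derive R_AbsRing (real_NormedModule V) (fun s => E (x s)) t (d t)) /\
     (forall t : R, 0 < t -> continuous d t)) /\
  (forall t : R, 0 <= t -> dom B (x t)) /\
  x 0 = x0 /\
  (forall t : R, 0 <= t -> is_derive_halfline (fun s => E (x s)) t (B (x t))).

(* Main.v *)
(** Let [N x = sqrt (Re <E x, Q x>)]. Dissipativity of [A] makes the operators
    [J_a = (E - a A Q)^{-1} E] contractions for the seminorm [N], so the implicit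
    Euler approximations [J_{t/n}^n] of an orbit of the relation [A Q x = E g]
    can be compared by telescoping commuting contractions: with [n = 2^k] they
    are Cauchy in [N], and [N] dominates [|E .|]. If [A Q x0 = E g] and
    [A Q g = E h], which is the case for [x0] in the range of the square of
    [(mu E - A Q)^{-1} E], the limits [v] and [w] of [E J_{t/n}^n x0] and
    [E J_{t/n}^n g] satisfy [v' = w], and [x = (mu E - A Q)^{-1} (mu v - w)] is
    the solution. Uniqueness holds because the energy [N x ^ 2] of a solution is
    nonincreasing and [N x = 0] forces [E x = 0], hence [A Q x = 0]. *)

Require Import Defs.
From Stdlib Require Import Reals ZArith Lra Lia ClassicalEpsilon.
From Coquelicot Require Import Coquelicot.

Local Open Scope R_scope.

(** The obstacle is the kernel of [E]: the relation [A Q x = E g] fixes [g] only modulo [ker E], and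
    the energy seminorm vanishes there, so the energy estimates alone give convergence only of the
    images under [E], in [Z]. The resolvent [S = (mu E - A Q)^{-1}] repairs this: [A Q p = E q]
    gives [p = S (mu E p - E q)], so convergence of [E p] and [E q] forces convergence of [p] in
    [X]; hence two limits are carried along. The second orbit starts at [g], for which only the
    single relation [A Q g = E h] is at hand, while comparing one Euler step with two half steps
    consumes two such relations. Convergence is therefore proved for starting points with one
    relation: the point is replaced by its image under [J_b], at a cost of order [b], and [b] is
    balanced against the step size. *)

Section InnerProduct.

Variable X : HilbertSpace.
Implicit Types x y z : X.

Lemma inner_zero_l z : inner zero z = RtoC 0.
Proof.
  transitivity (inner (scal (RtoC 0) (zero : X)) z).
  - f_equal; symmetry; exact (scal_zero_l (zero : X)).
  - rewrite inner_scal_l; exact (Cmult_0_l _).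
Qed.

Lemma inner_opp_l x z : inner (opp x) z = (- inner x z)%C.
Proof.
  transitivity (inner (scal (Copp (RtoC 1)) x) z).
  - f_equal; symmetry; exact (scal_opp_one x).
  - rewrite inner_scal_l; ring.
Qed.

Lemma inner_minus_l x y z : inner (minus x y) z = (inner x z - inner y z)%C.
Proof. unfold minus; rewrite inner_plus_l, inner_opp_l; reflexivity. Qed.

Lemma inner_rscal_l (a : R) x z :
  inner (rscal a x) z = (RtoC a * inner x z)%C.
Proof. exact (inner_scal_l (RtoC a) x z). Qed.

Lemma inner_eq x y : (forall z, inner x z = inner y z) -> x = y.
Proof.
  intros H.
  assert (H0 : inner (minus x y) (minus x y) = RtoC 0).
  { rewrite inner_minus_l, H; ring. }
  rewrite inner_norm in H0.
  apply (f_equal fst) in H0; cbn in H0.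
  assert (H1 : norm (minus x y) = 0) by nra.
  apply norm_eq_zero in H1.
  apply (plus_reg_r (opp y)).
  transitivity (zero : X); [exact H1 | symmetry; exact (plus_opp_r y)].
Qed.

End InnerProduct.

(* Vector identities become identities between real numbers after pairing with
   an arbitrary vector and separating real and imaginary parts. *)
Ltac vector :=
  apply inner_eq; let z := fresh "z" in intro z;
  repeat (rewrite inner_plus_l || rewrite inner_minus_l || rewrite inner_opp_l
          || rewrite inner_scal_l || rewrite inner_rscal_l
          || rewrite inner_zero_l);
  apply injective_projections;
  cbn [fst snd Cplus Cminus Copp Cmult RtoC]; field.

Lemma linear_minus {U V : NormedModule C_AbsRing} (f : U -> V) x y :
  is_linear f -> f (minus x y) = minus (f x) (f y).
Proof.
  intros Hf; unfold minus; rewrite (linear_plus f Hf), (linear_opp f _ Hf).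
  reflexivity.
Qed.

Lemma linear_rscal {U V : NormedModule C_AbsRing} (f : U -> V) (a : R) x :
  is_linear f -> f (rscal a x) = rscal a (f x).
Proof. intros Hf; exact (linear_scal f Hf (RtoC a) x). Qed.

(** * Limits and norm estimates in complex normed spaces *)

Section Limits.

Context {V : NormedModule C_AbsRing}.

Lemma norm_minus_le (x y : V) : norm (minus x y) <= norm x + norm y.
Proof. rewrite <- (norm_opp y); apply norm_triangle. Qed.

Lemma norm_minus_triangle (z x y : V) :
  norm (minus x y) <= norm (minus x z) + norm (minus y z).
Proof.
  rewrite (minus_trans z x y), <- (norm_opp (minus y z)), opp_minus.
  apply norm_triangle.
Qed.

Context {T : Type} {F : (T -> Prop) -> Prop} {FF : Filter F}.

Lemma filterlim_minus (u v : T -> V) (lu lv : V) :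
  filterlim u F (locally lu) -> filterlim v F (locally lv) ->
  filterlim (fun k => minus (u k) (v k)) F (locally (minus lu lv)).
Proof.
  intros Hu Hv; unfold minus.
  eapply filterlim_comp_2 with (h := plus); [exact Hu | | apply filterlim_plus].
  exact (filterlim_comp _ _ _ _ _ _ _ _ Hv (filterlim_opp lv)).
Qed.

Lemma filterlim_scal_const (u : T -> V) (l : V) (a : C) :
  filterlim u F (locally l) ->
  filterlim (fun k => scal a (u k)) F (locally (scal a l)).
Proof.
  intros Hu; exact (filterlim_comp _ _ _ _ _ _ _ _ Hu
    (filterlim_scal_r (a : C_AbsRing) l)).
Qed.

Lemma filterlim_linear {W : NormedModule C_AbsRing} (f : V -> W)
    (u : T -> V) (l : V) :
  is_linear f -> filterlim u F (locally l) ->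
  filterlim (fun k => f (u k)) F (locally (f l)).
Proof.
  intros Hf Hu; exact (filterlim_comp _ _ _ _ _ _ _ _ Hu (linear_cont f l Hf)).
Qed.

(** Shaped for Euler estimates, which hold only once the step is small enough and may carry an error
    proportional to the step [/ 2 ^ k]. *)
Lemma norm_limit_le (u : nat -> V) (l : V) (c d : R) :
  filterlim u eventually (locally l) ->
  eventually (fun k => norm (u k) <= c + d / 2 ^ k) -> norm l <= c.
Proof.
  intros Hu Hb.
  assert (Hn : is_lim_seq (fun k => norm (u k)) (norm l))
    by exact (filterlim_comp _ _ _ _ _ _ _ _ Hu (filterlim_norm l)).
  assert (Hc : is_lim_seq (fun k => c + d / 2 ^ k) c).
  { replace (Finite c) with (Finite (c + d * 0)) by (f_equal; ring).
    apply is_lim_seq_plus'; [apply is_lim_seq_const|].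
    apply (is_lim_seq_scal_l _ d 0).
    apply is_lim_seq_ext with (fun k => (/ 2) ^ k).
    - intro k; apply pow_inv.
    - apply is_lim_seq_geom; rewrite Rabs_pos_eq; lra. }
  exact (is_lim_seq_le_loc _ _ _ _ Hb Hn Hc).
Qed.

End Limits.

Section RealLinear.

Variable X : HilbertSpace.

(** Time steps are real, so real scalars suffice; unlike [is_linear], this demands no boundedness in
    the norm of [X], as the resolvents are controlled only in a seminorm. *)
Definition real_linear (f : X -> X) : Prop :=
  (forall x y, f (plus x y) = plus (f x) (f y)) /\
  (forall (a : R) x, f (rscal a x) = rscal a (f x)).

Lemma real_linear_minus f x y :
  real_linear f -> f (minus x y) = minus (f x) (f y).
Proof.
  intros [Hp Hs].
  replace (minus x y) with (plus x (rscal (-1) y)) by vector.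
  rewrite Hp, Hs; vector.
Qed.

Lemma real_linear_comp f g :
  real_linear f -> real_linear g -> real_linear (fun x => f (g x)).
Proof.
  intros [Hp Hs] [Gp Gs]; split; intros.
  - rewrite Gp, Hp; reflexivity.
  - rewrite Gs, Hs; reflexivity.
Qed.

Lemma real_linear_iter n f : real_linear f -> real_linear (Nat.iter n f).
Proof.
  intros Hf; induction n as [|n IH].
  - split; reflexivity.
  - exact (real_linear_comp _ _ Hf IH).
Qed.

End RealLinear.

Arguments real_linear {X} f.

Lemma iter_double (T : Type) (f : T -> T) n x :
  Nat.iter (2 * n) f x = Nat.iter n (fun y => f (f y)) x.
Proof.
  induction n as [|n IH]; [reflexivity|].
  replace (2 * S n)%nat with (S (S (2 * n))) by lia.
  rewrite !Nat.iter_succ, IH; reflexivity.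
Qed.

Lemma iter_commute (T : Type) (f g : T -> T) :
  (forall x, f (g x) = g (f x)) ->
  forall n x, Nat.iter n f (g x) = g (Nat.iter n f x).
Proof.
  intros H n x; induction n as [|n IH]; [reflexivity|].
  rewrite !Nat.iter_succ, IH; apply H.
Qed.

(** * Contractive resolvent families of a linear relation, and their implicit Euler schemes *)

Record is_seminorm {X : HilbertSpace} (N : X -> R) : Prop := {
  seminorm_pos : forall x, 0 <= N x;
  seminorm_plus : forall x y, N (plus x y) <= N x + N y;
  seminorm_rscal : forall (a : R) x, N (rscal a x) = Rabs a * N x
}.

Arguments seminorm_pos {X N}.
Arguments seminorm_plus {X N}.
Arguments seminorm_rscal {X N}.

(* [J a] plays the role of [(I - a B)^{-1}], where [B] is the linear relation
   with graph [G]. *)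
Record is_resolvent_family {X : HilbertSpace} (N : X -> R) (J : R -> X -> X)
    (G : X -> X -> Prop) (r : R) : Prop := {
  family_range : 0 < r;
  family_linear : forall a, 0 <= a < r -> real_linear (J a);
  family_contraction : forall a x, 0 <= a < r -> N (J a x) <= N x;
  family_zero : forall x, J 0 x = x;
  family_graph_plus : forall x x' g g', G x g -> G x' g' ->
    G (plus x x') (plus g g');
  family_graph_rscal : forall (c : R) x g, G x g -> G (rscal c x) (rscal c g);
  family_resolvent : forall a x g, 0 <= a < r -> G x g ->
    J a (minus x (rscal a g)) = x;
  family_smooth : forall a x, 0 < a < r ->
    G (J a x) (rscal (/ a) (minus (J a x) x))
}.

Arguments family_range {X N J G r}.
Arguments family_linear {X N J G r}.
Arguments family_contraction {X N J G r}.
Arguments family_zero {X N J G r}.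
Arguments family_graph_plus {X N J G r}.
Arguments family_graph_rscal {X N J G r}.
Arguments family_resolvent {X N J G r}.
Arguments family_smooth {X N J G r}.

Section Seminorm.

Variables (X : HilbertSpace) (N : X -> R).
Hypothesis N_seminorm : is_seminorm N.

Let N_pos := seminorm_pos N_seminorm.
Let N_plus := seminorm_plus N_seminorm.
Let N_rscal := seminorm_rscal N_seminorm.

Lemma seminorm_minus_sym x y : N (minus x y) = N (minus y x).
Proof.
  replace (minus x y) with (rscal (-1) (minus y x)) by vector.
  rewrite N_rscal, Rabs_left by lra; ring.
Qed.

Lemma seminorm_minus x y : N (minus x y) <= N x + N y.
Proof.
  replace (minus x y) with (plus x (rscal (-1) y)) by vector.
  apply Rle_trans with (1 := N_plus _ _).
  rewrite N_rscal, Rabs_left by lra; lra.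
Qed.

Lemma seminorm_triangle z x y : N (minus x y) <= N (minus x z) + N (minus z y).
Proof.
  replace (minus x y) with (plus (minus x z) (minus z y)) by vector.
  apply N_plus.
Qed.

Lemma contraction_iter (f : X -> X) :
  (forall x, N (f x) <= N x) -> forall n x, N (Nat.iter n f x) <= N x.
Proof.
  intros Hf n x; induction n as [|n IH]; [apply Rle_refl|].
  exact (Rle_trans _ _ _ (Hf _) IH).
Qed.

(** Telescoping: [S^(n+1) x - T^(n+1) x = S^n (S x - T x) + T (S^n x - T^n x)], where commutation
    moves [T] in front of [S^n]. *)
Lemma contraction_iter_minus (S T : X -> X) :
  real_linear S -> real_linear T ->
  (forall x, N (S x) <= N x) -> (forall x, N (T x) <= N x) ->
  (forall x, S (T x) = T (S x)) ->
  forall n x,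
  N (minus (Nat.iter n S x) (Nat.iter n T x)) <= INR n * N (minus (S x) (T x)).
Proof.
  intros LS LT CS CT ST n x; induction n as [|n IH].
  - replace (minus (Nat.iter 0 S x) (Nat.iter 0 T x))
      with (rscal 0 x) by (cbn; vector).
    rewrite N_rscal, Rabs_R0; cbn; lra.
  - apply Rle_trans with (1 := seminorm_triangle (Nat.iter n S (T x)) _ _).
    rewrite Nat.iter_succ_r, <- real_linear_minus by (apply real_linear_iter, LS).
    rewrite (iter_commute _ S T ST n x), Nat.iter_succ.
    rewrite <- (real_linear_minus _ _ _ _ LT).
    pose proof (contraction_iter S CS n (minus (S x) (T x))).
    pose proof (CT (minus (Nat.iter n S x) (Nat.iter n T x))).
    rewrite S_INR; lra.
Qed.

Variables (J : R -> X -> X) (G : X -> X -> Prop) (r : R).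
Hypothesis J_family : is_resolvent_family N J G r.

Let r_pos := family_range J_family.
Let J_linear := family_linear J_family.
Let J_contraction := family_contraction J_family.
Let J_0 := family_zero J_family.
Let G_plus := family_graph_plus J_family.
Let G_rscal := family_graph_rscal J_family.
Let G_resolvent := family_resolvent J_family.
Let G_smooth := family_smooth J_family.

(* For [a <> b] both sides equal [(a J_a x - b J_b x) / (a - b)]. *)
Lemma family_comm a b x : 0 <= a < r -> 0 <= b < r -> J a (J b x) = J b (J a x).
Proof.
  intros Ha Hb.
  destruct (Req_dec a b) as [->|Hab]; [reflexivity|].
  destruct (Req_dec a 0) as [->|Ha0]; [rewrite !J_0; reflexivity|].
  destruct (Req_dec b 0) as [->|Hb0]; [rewrite !J_0; reflexivity|].
  set (u := J a x); set (v := J b x).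
  set (y := rscal (/ (a - b)) (plus (rscal a u) (rscal (- b) v))).
  set (g := rscal (/ (a - b)) (minus u v)).
  assert (Gy : G y g).
  { replace g with (rscal (/ (a - b)) (plus (rscal a (rscal (/ a) (minus u x)))
      (rscal (- b) (rscal (/ b) (minus v x))))) by (unfold g; vector; lra).
    apply G_rscal, G_plus; apply G_rscal, G_smooth; lra. }
  (* Here [y - a g = v] and [y - b g = u], so [J a v = y = J b u] by [G_resolvent]. *)
  transitivity y.
  - rewrite <- (G_resolvent a y g Ha Gy) at 1; f_equal; unfold y, g; vector; lra.
  - rewrite <- (G_resolvent b y g Hb Gy) at 1; f_equal; unfold y, g; vector; lra.
Qed.

Lemma resolvent_step a x g : 0 <= a < r -> G x g ->
  J a x = plus x (rscal a (J a g)).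
Proof.
  intros Ha Hx.
  rewrite <- (G_resolvent _ _ _ Ha Hx) at 2.
  destruct (J_linear a Ha) as [_ Hs].
  rewrite (real_linear_minus _ _ _ _ (J_linear a Ha)), Hs; vector.
Qed.

(** By [resolvent_step], [J a g] is the difference quotient [(J a x - x) / a] that [G_smooth]
    attaches to [J a x]. Thus regularity passes along the Euler iteration. *)
Lemma graph_resolvent a x g : 0 <= a < r -> G x g -> G (J a x) (J a g).
Proof.
  intros Ha Hx; destruct (Req_dec a 0) as [->|Ha0].
  - rewrite !J_0; exact Hx.
  - replace (J a g) with (rscal (/ a) (minus (J a x) x)).
    + apply G_smooth; lra.
    + rewrite (resolvent_step a x g Ha Hx); vector; exact Ha0.
Qed.

Lemma graph_iter a x g n : 0 <= a < r -> G x g ->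
  G (Nat.iter n (J a) x) (Nat.iter n (J a) g).
Proof.
  intros Ha Hx; induction n as [|n IH]; [exact Hx|].
  exact (graph_resolvent _ _ _ Ha IH).
Qed.

Lemma graph_minus_rscal a x x' g g' : G x g -> G x' g' ->
  G (minus x (rscal a x')) (minus g (rscal a g')).
Proof.
  intros H H'.
  replace (minus x (rscal a x')) with (plus x (rscal (- a) x')) by vector.
  replace (minus g (rscal a g')) with (plus g (rscal (- a) g')) by vector.
  apply G_plus, G_rscal; assumption.
Qed.

(** The resolvent identity: expand [x] as [J b (x - b g)] in the first term and as [J a (x - a g)]
    in the second. *)
Lemma resolvent_minus a b x g : 0 <= a < r -> 0 <= b < r -> G x g ->
  minus (J a x) (J b x) = rscal (a - b) (J a (J b g)).
Proof.
  intros Ha Hb Hx.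
  pose proof (G_resolvent _ _ _ Ha Hx) as Ea.
  pose proof (G_resolvent _ _ _ Hb Hx) as Eb.
  destruct (J_linear a Ha) as [Pa Sa]; destruct (J_linear b Hb) as [Pb Sb].
  rewrite <- Ea at 2; rewrite <- Eb at 1.
  rewrite (family_comm b a) by assumption.
  rewrite !(real_linear_minus _ _ _ _ (J_linear b Hb)),
    !(real_linear_minus _ _ _ _ (J_linear a Ha)), !Sb, !Sa; vector.
Qed.

Lemma resolvent_minus_bound a b x g : 0 <= a < r -> 0 <= b < r -> G x g ->
  N (minus (J a x) (J b x)) <= Rabs (a - b) * N g.
Proof.
  intros Ha Hb Hx.
  rewrite (resolvent_minus _ _ _ _ Ha Hb Hx), N_rscal.
  apply Rmult_le_compat_l; [apply Rabs_pos|].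
  exact (Rle_trans _ _ _ (J_contraction _ _ Ha) (J_contraction _ _ Hb)).
Qed.

Lemma resolvent_minus_id_bound a x g : 0 <= a < r -> G x g ->
  N (minus (J a x) x) <= a * N g.
Proof.
  intros Ha Hx.
  pose proof (resolvent_minus_bound a 0 x g Ha (conj (Rle_refl 0) r_pos) Hx) as H.
  rewrite J_0, Rminus_0_r, Rabs_pos_eq in H by lra; exact H.
Qed.

(** Formally [(I - a B)^2 - (I - 2 a B) = a^2 B^2], so the difference is [- a^2 J_a^2 J_{2a} h]. The
    two graph hypotheses give meaning to [B^2 x = h]. *)
Lemma resolvent_halving_bound a x g h : 0 <= a -> 2 * a < r -> G x g -> G g h ->
  N (minus (J a (J a x)) (J (2 * a) x)) <= a ^ 2 * N h.
Proof.
  intros Ha0 Har Hx Hg.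
  assert (Ha : 0 <= a < r) by lra; assert (H2a : 0 <= 2 * a < r) by lra.
  destruct (J_linear a Ha) as [Pa Sa].
  destruct (J_linear _ H2a) as [Pb Sb].
  replace (minus (J a (J a x)) (J (2 * a) x))
    with (rscal (- a ^ 2) (J a (J a (J (2 * a) h)))).
  - rewrite N_rscal, Rabs_Ropp, Rabs_pos_eq by nra.
    apply Rmult_le_compat_l; [nra|].
    apply Rle_trans with (1 := J_contraction _ _ Ha).
    exact (Rle_trans _ _ _ (J_contraction _ _ Ha) (J_contraction _ _ H2a)).
  - assert (E1 : J a (J a (minus (minus x (rscal a g))
        (rscal a (minus g (rscal a h))))) = x).
    { rewrite (G_resolvent a (minus x (rscal a g))) by
        (try apply graph_minus_rscal; assumption).
      apply G_resolvent; assumption. }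
    rewrite <- (G_resolvent _ _ _ H2a Hx) at 1.
    rewrite <- E1 at 2.
    rewrite !(family_comm (2 * a) a) by assumption.
    rewrite <- !(real_linear_minus _ _ _ _ (J_linear a Ha)),
      <- (real_linear_minus _ _ _ _ (J_linear _ H2a)), <- !Sa, <- Sb.
    f_equal; f_equal; f_equal; vector.
Qed.

Lemma euler_lipschitz a b n x g : 0 <= a < r -> 0 <= b < r -> G x g ->
  N (minus (Nat.iter n (J a) x) (Nat.iter n (J b) x))
  <= INR n * Rabs (a - b) * N g.
Proof.
  intros Ha Hb Hx; rewrite Rmult_assoc.
  refine (Rle_trans _ _ _ (contraction_iter_minus (J a) (J b) _ _ _ _ _ n x) _);
    auto using family_comm.
  apply Rmult_le_compat_l; [apply pos_INR|].
  exact (resolvent_minus_bound _ _ _ _ Ha Hb Hx).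
Qed.

(** At [a = s / n], [b = t / n] the bound is [|s - t| (s / n + |s - t|) N h], quadratic in [s - t]
    in the limit; this makes the limit orbit of [g] the derivative of that of [x]. *)
Lemma euler_taylor a b n x g h : 0 <= a < r -> 0 <= b < r -> G x g -> G g h ->
  N (minus (minus (Nat.iter n (J a) x) (Nat.iter n (J b) x))
       (rscal (INR n * (a - b)) (Nat.iter n (J b) g)))
  <= INR n * Rabs (a - b) * (a + INR n * Rabs (a - b)) * N h.
Proof.
  intros Ha Hb Hx Hg.
  assert (La := J_linear a Ha); assert (Lb := J_linear b Hb).
  assert (Cab : forall y, J b (J a y) = J a (J b y)) by (intro; apply family_comm; assumption).
  assert (Pd : 0 <= Rabs (a - b)) by apply Rabs_pos.
  assert (Ph := N_pos h).
  induction n as [|n IH].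
  - replace (minus (minus _ _) _) with (rscal 0 x) by (cbn; vector).
    rewrite N_rscal, Rabs_R0; cbn; lra.
  - set (D := minus (minus _ _) _) in IH.
    assert (Pn : 0 <= INR n) by apply pos_INR.
    (* Recursion for the remainder: [D_(n+1) = J_b D_n + (a - b) J_b (J_a^(n+1) g - J_b^n g)]. The
       last difference is one extra step, at most [a N h], plus the Lipschitz bound for [g]. *)
    apply Rle_trans with (N (plus (J b D) (rscal (a - b) (J b
      (minus (Nat.iter (S n) (J a) g) (Nat.iter n (J b) g)))))).
    { apply Req_le; f_equal.
      unfold D; rewrite !(real_linear_minus _ _ _ _ Lb), (proj2 Lb).
      assert (E : Nat.iter (S n) (J a) x = plus (J b (Nat.iter n (J a) x))
        (rscal (a - b) (J b (Nat.iter (S n) (J a) g)))).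
      { rewrite Nat.iter_succ_r.
        replace (J a x) with (plus (J b x) (rscal (a - b) (J a (J b g)))).
        2:{ rewrite <- (resolvent_minus _ _ _ _ Ha Hb Hx); vector. }
        destruct (real_linear_iter _ n _ La) as [Pl Sl].
        rewrite Pl, Sl, <- Nat.iter_succ_r.
        rewrite !(iter_commute _ (J a) (J b)) by (intro; symmetry; apply Cab).
        reflexivity. }
      rewrite E, S_INR, !Nat.iter_succ; vector. }
    apply Rle_trans with (1 := N_plus _ _).
    rewrite N_rscal.
    pose proof (J_contraction b D Hb) as C1.
    pose proof (J_contraction b
      (minus (Nat.iter (S n) (J a) g) (Nat.iter n (J b) g)) Hb) as C2.
    pose proof (seminorm_triangle (Nat.iter n (J a) g)
      (Nat.iter (S n) (J a) g) (Nat.iter n (J b) g)) as C3.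
    assert (C4 : N (minus (Nat.iter (S n) (J a) g) (Nat.iter n (J a) g)) <= a * N h).
    { rewrite Nat.iter_succ_r, <- real_linear_minus by (apply real_linear_iter, La).
      apply Rle_trans with (2 := resolvent_minus_id_bound _ _ _ Ha Hg).
      apply contraction_iter; intro; apply J_contraction, Ha. }
    pose proof (euler_lipschitz a b n g h Ha Hb Hg) as C5.
    assert (C6 : Rabs (a - b) * N (J b (minus (Nat.iter (S n) (J a) g)
        (Nat.iter n (J b) g))) <= Rabs (a - b) * ((a + INR n * Rabs (a - b)) * N h)).
    { apply Rmult_le_compat_l; lra. }
    rewrite S_INR.
    apply Rle_trans with (INR n * Rabs (a - b) * (a + INR n * Rabs (a - b)) * N h
      + Rabs (a - b) * ((a + INR n * Rabs (a - b)) * N h)); [lra|].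
    assert (0 <= (INR n + 1) * Rabs (a - b) * Rabs (a - b) * N h) by
      (repeat apply Rmult_le_pos; lra).
    nra.
Qed.

(** Dyadic step numbers make every refinement split each step into two halves, the situation of
    [resolvent_halving_bound]. *)
Definition euler (k : nat) (t : R) : X -> X :=
  Nat.iter (2 ^ k) (J (t / 2 ^ k)).

Lemma INR_pow2 k : INR (2 ^ k) = 2 ^ k.
Proof. rewrite pow_INR; reflexivity. Qed.

Lemma eventually_small_step t d : 0 < d ->
  exists k0, forall k, (k0 <= k)%nat -> t / 2 ^ k < d.
Proof.
  intros Hd.
  destruct (Pow_x_infinity 2 ltac:(rewrite Rabs_pos_eq; lra) (t / d + 1)) as [k0 H].
  exists k0; intros k Hk; specialize (H k Hk).
  assert (P : 0 < 2 ^ k) by (apply pow_lt; lra).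
  rewrite Rabs_pos_eq in H by lra.
  apply Rmult_lt_reg_r with (2 ^ k / d); [apply Rdiv_lt_0_compat; assumption|].
  replace (t / 2 ^ k * (2 ^ k / d)) with (t / d) by (field; lra).
  replace (d * (2 ^ k / d)) with (2 ^ k) by (field; lra); lra.
Qed.

Lemma dyadic_step_diff k s t :
  INR (2 ^ k) * Rabs (s / 2 ^ k - t / 2 ^ k) = Rabs (s - t).
Proof.
  assert (P : 0 < 2 ^ k) by (apply pow_lt; lra).
  rewrite INR_pow2, <- (Rabs_pos_eq (2 ^ k)) at 1 by lra.
  rewrite <- Rabs_mult; f_equal; field; lra.
Qed.

Lemma step_range k0 t : 0 <= t ->
  (forall k, (k0 <= k)%nat -> t / 2 ^ k < r) ->
  forall k, (k0 <= k)%nat -> 0 <= t / 2 ^ k < r.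
Proof.
  intros Ht H k Hk; split; [|apply H; exact Hk].
  apply Rmult_le_pos; [exact Ht|].
  apply Rlt_le, Rinv_0_lt_compat, pow_lt; lra.
Qed.

(** Each of the [2 ^ k] split steps contributes [a ^ 2 * N h] with [a = t / 2 ^ S k]. *)
Lemma euler_succ_bound k t x g h : 0 <= t / 2 ^ k < r -> G x g -> G g h ->
  N (minus (euler (S k) t x) (euler k t x)) <= t ^ 2 * N h * / 2 ^ k / 4.
Proof.
  intros Ht Hx Hg; unfold euler.
  assert (P : 0 < 2 ^ k) by (apply pow_lt; lra).
  set (a := t / 2 ^ S k).
  assert (E : t / 2 ^ k = 2 * a) by (unfold a; cbn; field; lra).
  rewrite E in Ht |- *.
  assert (Ha : 0 <= a < r) by lra.
  assert (La := J_linear a Ha).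
  replace (2 ^ S k)%nat with (2 * 2 ^ k)%nat by (cbn; lia).
  rewrite iter_double.
  apply Rle_trans with (INR (2 ^ k) * (a ^ 2 * N h)).
  - refine (Rle_trans _ _ _ (contraction_iter_minus (fun y => J a (J a y))
      (J (2 * a)) _ _ _ _ _ _ x) _).
    + exact (real_linear_comp _ _ _ La La).
    + exact (J_linear _ Ht).
    + intro y; apply Rle_trans with (N (J a y)); auto.
    + intro y; auto.
    + intro y; rewrite (family_comm a (2 * a)), (family_comm a (2 * a)) by assumption.
      reflexivity.
    + apply Rmult_le_compat_l; [apply pos_INR|].
      apply resolvent_halving_bound with g; lra || assumption.
  - apply Req_le; rewrite INR_pow2; unfold a; cbn; field; lra.
Qed.

Lemma euler_cauchy_bound k0 t x g h : 0 <= t ->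
  (forall k, (k0 <= k)%nat -> t / 2 ^ k < r) -> G x g -> G g h ->
  forall k m, (k0 <= k)%nat ->
  N (minus (euler (m + k) t x) (euler k t x)) <= t ^ 2 * N h * / 2 ^ k / 2.
Proof.
  intros Ht Hr Hx Hg k m Hk.
  assert (P : forall j, 0 < / 2 ^ j)
    by (intro; apply Rinv_0_lt_compat, pow_lt; lra).
  assert (Q : 0 <= t ^ 2 * N h) by (apply Rmult_le_pos; auto; nra).
  (* The exact partial geometric sum is kept, since the final bound alone is not inductive. *)
  apply Rle_trans with (t ^ 2 * N h * (/ 2 ^ k - / 2 ^ (m + k)) / 2).
  - induction m as [|m IH].
    + replace (minus (euler (0 + k) t x) (euler k t x)) with (rscal 0 x)
        by (rewrite Nat.add_0_l; vector).
      rewrite N_rscal, Rabs_R0; cbn; lra.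
    + apply Rle_trans with (1 := seminorm_triangle (euler (m + k) t x) _ _).
      pose proof (euler_succ_bound (m + k) t x g h
        (step_range k0 t Ht Hr (m + k)%nat ltac:(lia)) Hx Hg) as S1.
      change (S m + k)%nat with (S (m + k)).
      replace (/ 2 ^ S (m + k)) with (/ 2 ^ (m + k) / 2)
        by (rewrite <- tech_pow_Rmult; field; apply pow_nonzero; lra).
      lra.
  - specialize (P (m + k)%nat); nra.
Qed.

(* One application of the resolvent makes [x] regular enough for
   [euler_cauchy_bound], at the price of the factor [/ b]. *)
Lemma euler_cauchy_bound_smoothing k0 t x g b : 0 <= t ->
  (forall k, (k0 <= k)%nat -> t / 2 ^ k < r) -> G x g -> 0 < b < r ->
  forall k m, (k0 <= k)%nat ->
  N (minus (euler (m + k) t x) (euler k t x))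
  <= 2 * b * N g + t ^ 2 * N g / b * / 2 ^ k.
Proof.
  intros Ht Hr Hx Hb k m Hk.
  assert (Hb' : 0 <= b < r) by lra.
  assert (Hx' := graph_resolvent _ _ _ Hb' Hx).
  (* The pair [J b x], [J b g] gains the second datum [(J b g - g) / b], of seminorm at most
     [2 N g / b]. *)
  assert (Hg' := G_smooth b g Hb).
  pose proof (euler_cauchy_bound k0 t _ _ _ Ht Hr Hx' Hg' k m Hk) as C.
  assert (D : forall j, (k0 <= j)%nat ->
      N (minus (euler j t (J b x)) (euler j t x)) <= b * N g).
  { intros j Hj.
    assert (Hj' := step_range k0 t Ht Hr j Hj).
    unfold euler; rewrite <- real_linear_minus by (apply real_linear_iter; auto).
    apply Rle_trans with (2 := resolvent_minus_id_bound _ _ _ Hb' Hx).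
    apply contraction_iter; auto. }
  assert (Nh : N (rscal (/ b) (minus (J b g) g)) <= / b * (2 * N g)).
  { rewrite N_rscal, Rabs_pos_eq by (apply Rlt_le, Rinv_0_lt_compat; lra).
    apply Rmult_le_compat_l; [apply Rlt_le, Rinv_0_lt_compat; lra|].
    pose proof (seminorm_minus (J b g) g); pose proof (J_contraction b g Hb'); lra. }
  pose proof (seminorm_triangle (euler (m + k) t (J b x))
    (euler (m + k) t x) (euler k t x)) as T1.
  pose proof (seminorm_triangle (euler k t (J b x))
    (euler (m + k) t (J b x)) (euler k t x)) as T2.
  rewrite (seminorm_minus_sym (euler (m + k) t x) (euler (m + k) t (J b x))) in T1.
  pose proof (D (m + k)%nat ltac:(lia)); pose proof (D k Hk).
  assert (P : 0 < / 2 ^ k) by (apply Rinv_0_lt_compat, pow_lt; lra).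
  assert (t ^ 2 * N (rscal (/ b) (minus (J b g) g)) * / 2 ^ k / 2
    <= t ^ 2 * (/ b * (2 * N g)) * / 2 ^ k / 2).
  { apply Rmult_le_compat_r; [lra|].
    apply Rmult_le_compat_r; [lra|].
    apply Rmult_le_compat_l; [nra|exact Nh]. }
  replace (t ^ 2 * N g / b * / 2 ^ k)
    with (t ^ 2 * (/ b * (2 * N g)) * / 2 ^ k / 2)
    by (field; split; [apply pow_nonzero|]; lra).
  lra.
Qed.

Lemma graph_euler k t x g : 0 <= t / 2 ^ k < r -> G x g ->
  G (euler k t x) (euler k t g).
Proof. apply graph_iter. Qed.

Lemma euler_zero k x : euler k 0 x = x.
Proof.
  unfold euler; replace (0 / 2 ^ k) with 0 by (unfold Rdiv; ring).
  induction (2 ^ k)%nat as [|n IH]; [reflexivity|].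
  rewrite Nat.iter_succ, J_0; exact IH.
Qed.

(** * Convergence of the Euler scheme after application of [E] *)

Variables (Z : HilbertSpace) (E : X -> Z) (K : R).
Hypothesis E_linear : is_linear E.
Hypothesis E_bound : forall x, norm (E x) <= K * N x.
Hypothesis K_pos : 0 <= K.

Lemma euler_converges x g t : 0 <= t -> G x g ->
  exists v : Z, filterlim (fun k => E (euler k t x)) eventually (locally v).
Proof.
  intros Ht Hx.
  apply (filterlim_locally_cauchy (U := CompleteNormedModule.CompleteSpace _ Z)).
  intros eps.
  destruct (eventually_small_step t r r_pos) as [k1 H1].
  set (M := K * N g).
  assert (PM : 0 <= M) by (apply Rmult_le_pos; auto).
  assert (Pe := cond_pos eps).
  (* First [b] brings the smoothing error [2 M b] below [eps / 4], then [k2] brings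
     [t ^ 2 * M / b / 2 ^ k] below [eps / 8]; the total stays under [eps / 2]. The [+ 1] covers
     [M = 0]. *)
  set (b := Rmin (r / 2) (eps / (8 * (M + 1)))).
  assert (Pb : 0 < eps / (8 * (M + 1))) by (apply Rdiv_lt_0_compat; lra).
  assert (Hb : 0 < b < r).
  { unfold b; apply Rmin_case_strong; lra. }
  assert (Mb : M * b <= eps / 8).
  { apply Rle_trans with ((M + 1) * (eps / (8 * (M + 1)))).
    - apply Rmult_le_compat; try lra; apply Rmin_r.
    - apply Req_le; field; lra. }
  destruct (eventually_small_step (t ^ 2 * M / b) (eps / 8) ltac:(lra)) as [k2 H2].
  set (k0 := Nat.max k1 k2).
  assert (C : forall k, (k0 <= k)%nat ->
      norm (minus (E (euler k t x)) (E (euler k0 t x))) < eps / 2).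
  { intros k Hk.
    replace k with ((k - k0) + k0)%nat by lia.
    rewrite <- (linear_minus E _ _ E_linear).
    apply Rle_lt_trans with (1 := E_bound _).
    pose proof (euler_cauchy_bound_smoothing k1 t x g b Ht H1 Hx Hb k0 (k - k0)
      ltac:(lia)) as C.
    apply (Rmult_le_compat_l K) in C; [|exact K_pos].
    apply Rle_lt_trans with (1 := C).
    specialize (H2 k0 ltac:(lia)).
    replace (K * (2 * b * N g + t ^ 2 * N g / b * / 2 ^ k0))
      with (2 * (M * b) + t ^ 2 * M / b / 2 ^ k0).
    - lra.
    - unfold M; field; split; try apply pow_nonzero; lra. }
  exists (fun k => (k0 <= k)%nat); split; [exists k0; auto|].
  intros k l Hk Hl; apply (norm_compat1 (V := Z)).
  apply Rle_lt_trans with (1 := norm_minus_triangle (V := Z) (E (euler k0 t x)) _ _).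
  rewrite <- (Rplus_half_diag eps).
  apply Rplus_lt_compat; [exact (C l Hl) | exact (C k Hk)].
Qed.

Lemma euler_limit_lipschitz x g s t vs vt : 0 <= s -> 0 <= t -> G x g ->
  filterlim (fun k => E (euler k s x)) eventually (locally vs) ->
  filterlim (fun k => E (euler k t x)) eventually (locally vt) ->
  norm (minus vs vt) <= K * N g * Rabs (s - t).
Proof.
  intros Hs Ht Hx Ls Lt.
  destruct (eventually_small_step s r r_pos) as [k1 H1].
  destruct (eventually_small_step t r r_pos) as [k2 H2].
  apply (norm_limit_le _ _ _ 0 (filterlim_minus _ _ _ _ Ls Lt)).
  exists (Nat.max k1 k2); intros k Hk.
  assert (Ra := step_range k1 s Hs H1 k ltac:(lia)).
  assert (Rb := step_range k2 t Ht H2 k ltac:(lia)).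
  rewrite <- (linear_minus E _ _ E_linear).
  apply Rle_trans with (1 := E_bound _).
  pose proof (euler_lipschitz _ _ (2 ^ k) x g Ra Rb Hx) as B.
  apply (Rmult_le_compat_l K) in B; [|exact K_pos].
  apply Rle_trans with (1 := B); apply Req_le.
  rewrite (dyadic_step_diff k s t); unfold Rdiv; ring.
Qed.

Lemma euler_limit_taylor x g h s t vs vt wt :
  0 <= s -> 0 <= t -> G x g -> G g h ->
  filterlim (fun k => E (euler k s x)) eventually (locally vs) ->
  filterlim (fun k => E (euler k t x)) eventually (locally vt) ->
  filterlim (fun k => E (euler k t g)) eventually (locally wt) ->
  norm (minus (minus vs vt) (rscal (s - t) wt)) <= K * N h * (s - t) ^ 2.
Proof.
  intros Hs Ht Hx Hg Ls Lt Lw.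
  destruct (eventually_small_step s r r_pos) as [k1 H1].
  destruct (eventually_small_step t r r_pos) as [k2 H2].
  (* This constant collects the term of [euler_taylor] with the factor [a = s / 2 ^ k], which
     vanishes in the limit. *)
  apply (norm_limit_le _ _ _ (K * N h * Rabs (s - t) * s)
    (filterlim_minus _ _ _ _ (filterlim_minus _ _ _ _ Ls Lt)
       (filterlim_scal_const _ _ (RtoC (s - t)) Lw))).
  exists (Nat.max k1 k2); intros k Hk.
  assert (Ra := step_range k1 s Hs H1 k ltac:(lia)).
  assert (Rb := step_range k2 t Ht H2 k ltac:(lia)).
  rewrite <- (linear_minus E _ _ E_linear), <- (linear_scal E E_linear),
    <- (linear_minus E _ _ E_linear).
  apply Rle_trans with (1 := E_bound _).
  pose proof (euler_taylor _ _ (2 ^ k) x g h Ra Rb Hx Hg) as B.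
  apply (Rmult_le_compat_l K) in B; [|exact K_pos].
  assert (P : 2 ^ k <> 0) by (apply pow_nonzero; lra).
  rewrite (dyadic_step_diff k s t), INR_pow2 in B.
  replace (2 ^ k * (s / 2 ^ k - t / 2 ^ k)) with (s - t) in B by (field; exact P).
  apply Rle_trans with (1 := B); apply Req_le.
  rewrite <- (pow2_abs (s - t)); field; exact P.
Qed.

End Seminorm.

(** * Cauchy-Schwarz and the triangle inequality for semidefinite forms *)

Section EnergyForm.

Variables (X : HilbertSpace) (b : X -> X -> R).
Hypothesis b_plus : forall x y z, b (plus x y) z = b x z + b y z.
Hypothesis b_rscal : forall (a : R) x z, b (rscal a x) z = a * b x z.
Hypothesis b_sym : forall x y, b x y = b y x.
Hypothesis b_pos : forall x, 0 <= b x x.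

Lemma form_plus_r x y z : b z (plus x y) = b z x + b z y.
Proof. rewrite b_sym, b_plus, (b_sym x), (b_sym y); reflexivity. Qed.

Lemma form_rscal_r a x z : b z (rscal a x) = a * b z x.
Proof. rewrite b_sym, b_rscal, b_sym; reflexivity. Qed.

Lemma form_cauchy_schwarz x y : b x y <= sqrt (b x x) * sqrt (b y y).
Proof.
  assert (D : forall t, 0 <= b x x - 2 * t * b x y + t ^ 2 * b y y).
  { intro t; generalize (b_pos (plus x (rscal (- t) y))).
    rewrite b_plus, b_rscal, !form_plus_r, !form_rscal_r, (b_sym y x); intros H.
    apply Rle_trans with (1 := H), Req_le; ring. }
  rewrite <- sqrt_mult by auto.
  apply Rle_trans with (1 := Rle_abs _).
  rewrite <- sqrt_Rsqr_abs; apply sqrt_le_1_alt; unfold Rsqr.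
  pose proof (b_pos x); pose proof (b_pos y).
  destruct (Req_dec (b y y) 0) as [Hy|Hy].
  - destruct (Req_dec (b x y) 0) as [->|Hxy]; [nra|].
    (* The form may be degenerate. With [b y y = 0] the quadratic is affine in [t], and this [t]
       gives it the value [-1]. *)
    specialize (D ((b x x + 1) / (2 * b x y))).
    replace (2 * ((b x x + 1) / (2 * b x y)) * b x y) with (b x x + 1) in D
      by (field; assumption).
    rewrite Hy in D; lra.
  - specialize (D (b x y / b y y)).
    replace (b x x - 2 * (b x y / b y y) * b x y + (b x y / b y y) ^ 2 * b y y)
      with ((b x x * b y y - b x y * b x y) / b y y) in D by (field; assumption).
    apply (Rmult_le_compat_r (b y y)) in D; [|assumption].
    unfold Rdiv in D; rewrite Rmult_assoc, Rinv_l in D by assumption; lra.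
Qed.

Lemma form_sqrt_plus x y :
  sqrt (b (plus x y) (plus x y)) <= sqrt (b x x) + sqrt (b y y).
Proof.
  assert (Px := sqrt_pos (b x x)); assert (Py := sqrt_pos (b y y)).
  apply Rsqr_incr_0_var; [|lra].
  rewrite Rsqr_sqrt by apply b_pos; unfold Rsqr.
  rewrite b_plus, !form_plus_r, (b_sym y x).
  pose proof (form_cauchy_schwarz x y).
  pose proof (sqrt_sqrt _ (b_pos x)); pose proof (sqrt_sqrt _ (b_pos y)); nra.
Qed.

Lemma form_sqrt_rscal a x :
  sqrt (b (rscal a x) (rscal a x)) = Rabs a * sqrt (b x x).
Proof.
  rewrite b_rscal, form_rscal_r, <- sqrt_Rsqr_abs, <- sqrt_mult_alt
    by apply Rle_0_sqr.
  f_equal; unfold Rsqr; ring.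
Qed.

End EnergyForm.

Lemma Re_inner_le (X : HilbertSpace) (x y : X) :
  Re (inner x y) <= norm x * norm y.
Proof.
  assert (S : forall z : X, sqrt (Re (inner z z)) = norm z).
  { intro z; rewrite inner_norm; apply sqrt_pow2, norm_ge_0. }
  rewrite <- !S; apply (form_cauchy_schwarz X (fun u v => Re (inner u v))).
  - intros; rewrite inner_plus_l; reflexivity.
  - intros; rewrite inner_rscal_l; unfold Re; cbn; ring.
  - intros u v; rewrite inner_conj; reflexivity.
  - intro u; rewrite inner_norm; cbn; pose proof (norm_ge_0 u); nra.
Qed.

Lemma norm_inner_sq (X : HilbertSpace) (x : X) : norm x ^ 2 = Re (inner x x).
Proof. rewrite inner_norm; reflexivity. Qed.

Lemma Rabs_Re_inner_le (X : HilbertSpace) (x y : X) :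
  Rabs (Re (inner x y)) <= norm x * norm y.
Proof.
  apply Rabs_le; split; [|apply Re_inner_le].
  pose proof (Re_inner_le X (opp x) y) as H.
  rewrite inner_opp_l in H.
  replace (norm (opp x)) with (norm x) in H by (symmetry; exact (norm_opp (V := X) x)).
  change (- Re (inner x y) <= norm x * norm y) in H; lra.
Qed.

(** * Continuity and differentiation on the half-line *)

Section HalfLine.

Variable V : NormedModule C_AbsRing.

Definition at_halfline (t : R) : (R -> Prop) -> Prop :=
  within (fun s => 0 <= s) (locally t).

Lemma at_halfline_proper t : 0 <= t -> ProperFilter (at_halfline t).
Proof.
  intros Ht; constructor; [|apply within_filter, locally_filter].
  intros P HP; exists t; exact (locally_singleton _ _ HP Ht).
Qed.

Lemma at_halfline_lim t : is_filter_lim (at_halfline t) t.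
Proof. intros P HP; exact (filter_le_within _ _ HP). Qed.

Lemma locally_of_halfline t P : 0 < t -> at_halfline t P -> locally t P.
Proof.
  intros Ht HP; generalize (filter_and _ _ (open_gt 0 t Ht) HP).
  apply filter_imp; intros s [Hs H]; apply H, Rlt_le, Hs.
Qed.

Lemma at_halfline_close t d : 0 < d ->
  at_halfline t (fun s => 0 <= s /\ Rabs (s - t) < d).
Proof.
  intros Hd; exists (mkposreal d Hd); intros s Hs H0; split; [exact H0 | exact Hs].
Qed.

Lemma halfline_lipschitz_continuous (f : R -> V) L t : 0 <= t ->
  (forall s, 0 <= s -> norm (minus (f s) (f t)) <= L * Rabs (s - t)) ->
  filterlim f (at_halfline t) (locally (f t)).
Proof.
  intros Ht HL; apply (filterlim_locally_ball_norm (K := C_AbsRing)); intros eps.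
  assert (P : 0 < Rabs L + 1) by (pose proof (Rabs_pos L); lra).
  generalize (at_halfline_close t (eps / (Rabs L + 1))
    ltac:(apply Rdiv_lt_0_compat; [apply cond_pos | exact P])).
  apply filter_imp; intros s [Hs Hd].
  apply Rle_lt_trans with (1 := HL s Hs).
  apply Rle_lt_trans with ((Rabs L + 1) * Rabs (s - t)).
  - apply Rmult_le_compat_r; [apply Rabs_pos|]; pose proof (Rle_abs L); lra.
  - apply (Rmult_lt_compat_l _ _ _ P) in Hd.
    replace (pos eps) with ((Rabs L + 1) * (eps / (Rabs L + 1))) by (field; lra).
    exact Hd.
Qed.

Lemma is_linear_rscal_l (l : V) :
  @is_linear R_AbsRing R_NormedModule (real_NormedModule V)
    (fun h => @scal _ (real_NormedModule V) h l).
Proof. exact (is_linear_scal_l (l : real_NormedModule V)). Qed.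

Lemma halfline_derive_quadratic (f : R -> V) (l : V) C t : 0 <= t ->
  (forall s, 0 <= s ->
     norm (minus (minus (f s) (f t)) (rscal (s - t) l)) <= C * (s - t) ^ 2) ->
  is_derive_halfline f t l.
Proof.
  intros Ht HC; split; [apply is_linear_rscal_l|].
  (* [filterdiff] quantifies over all limits of the filter; uniqueness of limits leaves only [t]. *)
  intros t' Ht' eps.
  assert (PF := at_halfline_proper t Ht).
  rewrite <- (is_filter_lim_unique (V := R_NormedModule) t t' (at_halfline_lim t) Ht').
  clear t' Ht'.
  assert (P : 0 < Rabs C + 1) by (pose proof (Rabs_pos C); lra).
  generalize (at_halfline_close t (eps / (Rabs C + 1))
    ltac:(apply Rdiv_lt_0_compat; [apply cond_pos | exact P])).
  apply filter_imp; intros s [Hs Hd].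
  apply Rle_trans with (1 := HC s Hs).
  change (C * (s - t) ^ 2 <= eps * Rabs (s - t)).
  rewrite <- (pow2_abs (s - t)).
  apply (Rmult_lt_compat_l _ _ _ P) in Hd.
  replace ((Rabs C + 1) * (eps / (Rabs C + 1))) with (pos eps) in Hd by (field; lra).
  pose proof (Rabs_pos (s - t)); pose proof (Rle_abs C); nra.
Qed.

Lemma halfline_derive_is_derive (f : R -> V) (l : V) t : 0 < t ->
  is_derive_halfline f t l -> @is_derive R_AbsRing (real_NormedModule V) f t l.
Proof.
  intros Ht [Hl Hd]; split; [exact Hl|].
  intros t' Ht' eps.
  apply (is_filter_lim_locally_unique (V := R_NormedModule)) in Ht'; subst t'.
  apply locally_of_halfline; [exact Ht|].
  exact (Hd t (at_halfline_lim t) eps).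
Qed.

Lemma halfline_derive_bound (f : R -> V) (l : V) t eps : 0 < eps ->
  is_derive_halfline f t l ->
  at_halfline t (fun s =>
    norm (minus (minus (f s) (f t)) (rscal (s - t) l)) <= eps * Rabs (s - t)).
Proof.
  intros He [_ Hd]; exact (Hd t (at_halfline_lim t) (mkposreal eps He)).
Qed.

Lemma halfline_derive_minus (f g : R -> V) (lf lg : V) t :
  is_derive_halfline f t lf -> is_derive_halfline g t lg ->
  is_derive_halfline (fun s => minus (f s) (g s)) t (minus lf lg).
Proof.
  intros Hf Hg.
  assert (FF : Filter (within (fun s => 0 <= s) (locally t)))
    by apply within_filter, locally_filter.
  refine (@filterdiff_ext_lin R_AbsRing R_NormedModule (real_NormedModule V) _ FF
    _ _ _ (@filterdiff_minus_fct R_AbsRing R_NormedModule (real_NormedModule V)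
      _ FF f g _ _ Hf Hg) _).
  intro h; symmetry.
  exact (scal_minus_distr_l (h : R_AbsRing) (lf : real_NormedModule V) lg).
Qed.

End HalfLine.

(** A point [t + h] with [h > 0] stays in the half-line even for [t = 0]; relative error
    [norm l / 2] there bounds the norm of [h l] by [h * norm l / 2]. *)
Lemma halfline_derive_zero (X : HilbertSpace) (f : R -> X) (l : X) t : 0 <= t ->
  (forall s, 0 <= s -> f s = zero) -> is_derive_halfline f t l -> l = zero.
Proof.
  intros Ht Hf Hl; apply (norm_eq_zero (V := X)).
  destruct (Rle_lt_or_eq _ _ (norm_ge_0 l)) as [Pl|<-]; [|reflexivity].
  destruct (halfline_derive_bound X f l t (norm l / 2) ltac:(lra) Hl) as [d Hd].
  assert (Pd := cond_pos d); set (h := d / 2).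
  assert (Hh : t + h - t = h) by ring.
  specialize (Hd (t + h)); cbv beta in Hd; rewrite Hh in Hd.
  rewrite !Hf in Hd by (unfold h; lra).
  rewrite (Rabs_pos_eq h) in Hd by (unfold h; lra).
  specialize (Hd ltac:(change (Rabs (t + h - t) < d);
    rewrite Hh, Rabs_pos_eq; unfold h; lra) ltac:(unfold h; lra)).
  set (u := minus (minus zero zero) (rscal h l)) in Hd.
  (* [norm_rscal] is only an upper bound, so [l] is expressed through [u] instead of computing the
     norm of [u]. *)
  assert (E : l = rscal (- / h) u) by (unfold u, h; vector; lra).
  pose proof (norm_rscal (- / h) u) as N.
  change (@abs R_AbsRing (- / h)) with (Rabs (- / h)) in N.
  assert (Pih : 0 < / h) by (apply Rinv_0_lt_compat; unfold h; lra).
  rewrite <- E, Rabs_Ropp, Rabs_pos_eq in N by lra.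
  assert (B : norm l <= norm l / 2); [|lra].
  apply Rle_trans with (1 := N).
  replace (norm l / 2) with (/ h * (norm l / 2 * h)) by (field; unfold h; lra).
  apply Rmult_le_compat_l; [apply Rlt_le, Pih | exact Hd].
Qed.

(* [f] is extended to negative arguments by its value at [0], which makes it
   continuous on the whole line, as required by the mean value theorem. *)
Lemma halfline_nonincreasing (f df : R -> R) t :
  (forall s eps, 0 <= s -> 0 < eps -> at_halfline s (fun u =>
     Rabs (f u - f s - (u - s) * df s) <= eps * Rabs (u - s))) ->
  (forall s, 0 <= s -> df s <= 0) -> 0 <= t -> f t <= f 0.
Proof.
  intros Hd Hn Ht.
  set (g := fun s => f (Rmax 0 s)).
  assert (Dg : forall s, 0 < s -> is_derive g s (df s)).
  { intros s Hs.
    apply is_derive_ext_loc with f.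
    { generalize (open_gt 0 s Hs); apply filter_imp; intros u Hu.
      unfold g; rewrite Rmax_right; [reflexivity | apply Rlt_le, Hu]. }
    split; [apply is_linear_scal_l|].
    intros s' Hs' eps.
    apply (is_filter_lim_locally_unique (V := R_NormedModule)) in Hs'; subst s'.
    apply locally_of_halfline; [exact Hs|].
    exact (Hd s eps (Rlt_le _ _ Hs) (cond_pos eps)). }
  assert (Cg : forall s, 0 <= s -> continuity_pt g s).
  { intros s Hs; apply continuity_pt_filterlim, filterlim_locally; intros eps.
    (* Relative error [1] already gives [|f w - f s| <= (1 + |df s|) |w - s|] near [s], hence
       continuity. *)
    destruct (Hd s 1 Hs Rlt_0_1) as [d Hd'].
    set (L := 1 + Rabs (df s)).
    assert (PL : 0 < L) by (unfold L; pose proof (Rabs_pos (df s)); lra).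
    assert (Pe := cond_pos eps); assert (Pd := cond_pos d).
    assert (Pm : 0 < Rmin d (eps / L)).
    { apply Rmin_case; [exact Pd | apply Rdiv_lt_0_compat; assumption]. }
    exists (mkposreal _ Pm); intros u Hu.
    change (Rabs (u - s) < Rmin d (eps / L)) in Hu.
    assert (Hu' : Rabs (Rmax 0 u - s) <= Rabs (u - s)).
    { unfold Rmax; destruct Rle_dec; unfold Rabs; repeat destruct Rcase_abs; lra. }
    change (Rabs (g u - g s) < eps); unfold g.
    rewrite (Rmax_right 0 s Hs).
    set (w := Rmax 0 u) in *.
    pose proof (Rmin_l d (eps / L)); pose proof (Rmin_r d (eps / L)).
    assert (B : Rabs (f w - f s - (w - s) * df s) <= 1 * Rabs (w - s)).
    { apply Hd'; [|apply Rmax_l].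
      change (Rabs (w - s) < d); lra. }
    replace (f w - f s) with ((f w - f s - (w - s) * df s) + (w - s) * df s) by ring.
    apply Rle_lt_trans with (1 := Rabs_triang _ _); rewrite Rabs_mult.
    apply Rle_lt_trans with (L * Rabs (w - s)); [unfold L; lra|].
    apply Rle_lt_trans with (L * Rabs (u - s)); [apply Rmult_le_compat_l; lra|].
    replace (pos eps) with (L * (eps / L)) by (field; lra).
    apply Rmult_lt_compat_l; lra. }
  destruct (MVT_gen g 0 t df) as [c [Hc E]].
  - rewrite Rmin_left, Rmax_right by exact Ht; intros s [Hs _]; apply Dg, Hs.
  - rewrite Rmin_left, Rmax_right by exact Ht; intros s [Hs _]; apply Cg, Hs.
  - rewrite Rmin_left, Rmax_right in Hc by exact Ht.
    unfold g in E; rewrite Rmax_right, (Rmax_left 0 0) in E by lra.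
    pose proof (Hn c (proj1 Hc)); nra.
Qed.

Lemma minus_eq_swap (X : HilbertSpace) (x y z : X) :
  minus x y = z -> y = minus x z.
Proof. intros <-; vector. Qed.

(** * Energy estimates and solutions for the port-Hamiltonian equation *)

Section PortHamiltonian.

Variables (X Z : HilbertSpace) (E : X -> Z) (A : partial_op Z Z) (Q : X -> Z).
Hypothesis pH : pH_DAE E A Q.

Let E_linear : is_linear E := pH_E_bounded pH.
Let Q_linear : is_linear Q := pH_Q_bounded pH.

Definition energy_form (x y : X) : R := Re (inner (E x) (Q y)).

Definition energy_norm (x : X) : R := sqrt (energy_form x x).

Lemma energy_form_plus x y z :
  energy_form (plus x y) z = energy_form x z + energy_form y z.
Proof.
  unfold energy_form; rewrite (linear_plus E E_linear), inner_plus_l; reflexivity.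
Qed.

Lemma energy_form_rscal a x z : energy_form (rscal a x) z = a * energy_form x z.
Proof.
  unfold energy_form; rewrite (linear_rscal E a x E_linear), inner_rscal_l.
  unfold Re; cbn; ring.
Qed.

(** From [E^* Q = Q^* E]: moving [E] to the right and [Q] back to the left exchanges the arguments
    up to conjugation, which the real part ignores. *)
Lemma energy_form_sym x y : energy_form x y = energy_form y x.
Proof.
  destruct (pH_EQ pH) as (Es & Qs & [_ HE] & [_ HQ] & HEQ & _).
  unfold energy_form; rewrite HE, HEQ, <- HQ, inner_conj; reflexivity.
Qed.

Lemma energy_form_pos x : 0 <= energy_form x x.
Proof.
  destruct (pH_EQ pH) as (Es & Qs & [_ HE] & _ & _ & Hpos).
  unfold energy_form; rewrite HE, inner_conj; exact (proj2 (Hpos x)).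
Qed.

Lemma energy_form_le x y : energy_form x y <= energy_norm x * energy_norm y.
Proof.
  apply form_cauchy_schwarz; auto using energy_form_plus, energy_form_rscal,
    energy_form_sym, energy_form_pos.
Qed.

Lemma energy_norm_pos x : 0 <= energy_norm x.
Proof. apply sqrt_pos. Qed.

Lemma energy_norm_sq x : energy_norm x ^ 2 = energy_form x x.
Proof. apply pow2_sqrt, energy_form_pos. Qed.

Lemma energy_norm_plus x y :
  energy_norm (plus x y) <= energy_norm x + energy_norm y.
Proof.
  apply (form_sqrt_plus X energy_form); auto using energy_form_plus,
    energy_form_rscal, energy_form_sym, energy_form_pos.
Qed.

Lemma energy_norm_rscal a x : energy_norm (rscal a x) = Rabs a * energy_norm x.
Proof.
  apply (form_sqrt_rscal X energy_form); auto using energy_form_plus,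
    energy_form_rscal, energy_form_sym, energy_form_pos.
Qed.

Lemma energy_norm_seminorm : is_seminorm energy_norm.
Proof.
  split; [exact energy_norm_pos | exact energy_norm_plus | exact energy_norm_rscal].
Qed.

(* Cauchy-Schwarz for the energy form, applied to [x] and [Q^{-1} E x]. *)
Lemma energy_norm_controls_E :
  exists K, 0 <= K /\ forall x, norm (E x) <= K * energy_norm x.
Proof.
  destruct (pH_Q_invertible pH) as (Qi & LQi & HQi & _).
  assert (L : is_linear (fun z => E (Qi z))) by exact (is_linear_comp _ _ LQi E_linear).
  (* [M] bounds [E Q^{-1}]. For [y = Q^{-1} E x] the energy is
     [Re <E Q^{-1} (E x), E x> <= M |E x|^2], while the form at [x], [y] equals [|E x|^2]; hence the
     constant [sqrt M]. *)
  destruct (linear_norm _ L) as (M & PM & HM).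
  exists (sqrt M); split; [apply sqrt_pos|]; intros x.
  set (e := norm (E x)); set (y := Qi (E x)).
  assert (Pe : 0 <= e) by apply norm_ge_0.
  assert (Qy : Q y = E x) by exact (proj2 (HQi (E x))).
  assert (Ny : energy_norm y <= sqrt M * e).
  { unfold energy_norm, energy_form; rewrite Qy.
    rewrite <- (sqrt_pow2 e Pe), <- sqrt_mult by nra.
    apply sqrt_le_1_alt.
    apply Rle_trans with (1 := Re_inner_le _ _ _); fold e.
    replace (M * e ^ 2) with (M * e * e) by ring.
    apply Rmult_le_compat_r; [exact Pe | exact (HM (E x))]. }
  assert (Se : e ^ 2 <= energy_norm x * (sqrt M * e)).
  { apply Rle_trans with (energy_form x y).
    - unfold energy_form; rewrite Qy, <- norm_inner_sq; apply Rle_refl.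
    - apply Rle_trans with (1 := energy_form_le x y).
      apply Rmult_le_compat_l; [apply energy_norm_pos | exact Ny]. }
  destruct (Req_dec e 0) as [He|He].
  - rewrite He; apply Rmult_le_pos; [apply sqrt_pos | apply energy_norm_pos].
  - apply Rmult_le_reg_r with e; lra.
Qed.

(* The linear relation which the equation induces modulo [ker E]. *)
Definition dae_graph (x g : X) : Prop := dom A (Q x) /\ A (Q x) = E g.

Lemma dom_AQ_plus x y : dom A (Q x) -> dom A (Q y) ->
  dom A (Q (plus x y)) /\ A (Q (plus x y)) = plus (A (Q x)) (A (Q y)).
Proof.
  destruct (pH_A_linear pH) as (_ & Hp & _); intros Hx Hy.
  rewrite (linear_plus Q Q_linear); exact (Hp _ _ Hx Hy).
Qed.

Lemma dom_AQ_scal (a : C) x : dom A (Q x) ->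
  dom A (Q (scal a x)) /\ A (Q (scal a x)) = scal a (A (Q x)).
Proof.
  destruct (pH_A_linear pH) as (_ & _ & Hs); intros Hx.
  rewrite (linear_scal Q Q_linear); exact (Hs _ _ Hx).
Qed.

Lemma dom_AQ_minus x y : dom A (Q x) -> dom A (Q y) ->
  dom A (Q (minus x y)) /\ A (Q (minus x y)) = minus (A (Q x)) (A (Q y)).
Proof.
  intros Hx Hy.
  replace (minus x y) with (plus x (rscal (-1) y)) by vector.
  destruct (dom_AQ_scal (RtoC (-1)) y Hy) as [Dy Ey].
  destruct (dom_AQ_plus x (rscal (-1) y) Hx Dy) as [D Exy]; split; [exact D|].
  rewrite Exy.
  replace (A (Q (rscal (-1) y))) with (rscal (-1) (A (Q y))) by (symmetry; exact Ey).
  vector.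
Qed.

Lemma dae_graph_plus x x' g g' : dae_graph x g -> dae_graph x' g' ->
  dae_graph (plus x x') (plus g g').
Proof.
  intros [Dx Ex] [Dx' Ex']; destruct (dom_AQ_plus x x' Dx Dx') as [D Ep].
  split; [exact D|]; rewrite Ep, Ex, Ex', (linear_plus E E_linear); reflexivity.
Qed.

Lemma dae_graph_scal (c : C) x g : dae_graph x g -> dae_graph (scal c x) (scal c g).
Proof.
  intros [Dx Ex]; destruct (dom_AQ_scal c x Dx) as [D Es].
  split; [exact D|]; rewrite Es, Ex, (linear_scal E E_linear); reflexivity.
Qed.

Lemma dae_graph_minus x x' g g' : dae_graph x g -> dae_graph x' g' ->
  dae_graph (minus x x') (minus g g').
Proof.
  intros [Dx Ex] [Dx' Ex']; destruct (dom_AQ_minus x x' Dx Dx') as [D Ep].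
  split; [exact D|]; rewrite Ep, Ex, Ex', (linear_minus E _ _ E_linear); reflexivity.
Qed.

(** [Re <E g, Q x> = Re <A Q x, Q x>]: dissipativity of [A] at [Q x] becomes dissipativity of the
    relation for the energy form. *)
Lemma dae_graph_dissipative x g : dae_graph x g -> energy_form g x <= 0.
Proof.
  intros [Dx Ex]; unfold energy_form; rewrite <- Ex.
  exact (pH_A_dissipative pH Dx).
Qed.

Section Resolvent.

Variables (mu : C) (S : Z -> X).
Hypothesis S_resolvent : is_resolvent E (comp_op A Q) mu S.

(** Solving [(mu E - A Q) x = E f] for [A Q x] gives [E (mu x - f)]. Each factor
    [(mu E - A Q)^{-1} E] in front of a vector thus yields one explicit relation. *)
Lemma resolvent_graph f :
  dae_graph (S (E f)) (minus (scal mu (S (E f))) f).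
Proof.
  destruct S_resolvent as (_ & HS & _); destruct (HS (E f)) as [D Es].
  split; [exact D|].
  rewrite (linear_minus E _ _ E_linear), (linear_scal E E_linear).
  exact (minus_eq_swap _ _ _ _ Es).
Qed.

Lemma resolvent_of_graph x g : dae_graph x g ->
  S (minus (scal mu (E x)) (E g)) = x.
Proof.
  intros [Dx Ex]; destruct S_resolvent as (_ & _ & HS).
  rewrite <- Ex; exact (HS x Dx).
Qed.

(** Since [(mu E - A Q) x = mu v - w], knowing [E x = v] cancels the [mu] terms. The equation is
    obtained algebraically, with no limit taken through [A]. *)
Lemma resolvent_solves v w :
  let x := S (minus (scal mu v) w) in
  E x = v -> dom A (Q x) /\ A (Q x) = w.
Proof.
  intros x Ex; destruct S_resolvent as (_ & HS & _).
  destruct (HS (minus (scal mu v) w)) as [D Es].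
  split; [exact D|].
  apply minus_eq_swap in Es; cbn in Es; fold x in Es.
  rewrite Es, Ex; vector.
Qed.

End Resolvent.

Lemma dae_step_operators :
  (exists omega : R, 0 < omega /\
     forall lambda : C, omega < Re lambda ->
       resolvent_set E (comp_op A Q) lambda) ->
  exists (r : R) (J : R -> X -> X), is_resolvent_family energy_norm J dae_graph r.
Proof.
  intros (omega & Pomega & Hres).
  set (S := fun lambda : R => epsilon (inhabits (fun _ : Z => zero : X))
    (is_resolvent E (comp_op A Q) (RtoC lambda))).
  assert (HS : forall a, 0 < a < / omega ->
      is_resolvent E (comp_op A Q) (RtoC (/ a)) (S (/ a))).
  { intros a Ha; apply epsilon_spec, Hres; cbn.
    rewrite <- (Rinv_inv omega); apply Rinv_0_lt_contravar; lra. }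
  (* [(E - a A Q)^{-1} E] is [/ a] times the resolvent at [/ a] after [E], so steps
     [0 < a < / omega] are admissible; at [a = 0] the identity is put in by hand. *)
  set (J := fun a x => if Req_EM_T a 0 then x else rscal (/ a) (S (/ a) (E x))).
  assert (J_0 : forall x, J 0 x = x).
  { intro x; unfold J; destruct (Req_EM_T 0 0); [reflexivity | lra]. }
  assert (J_pos : forall a x, 0 < a -> J a x = rscal (/ a) (S (/ a) (E x))).
  { intros a x Ha; unfold J; destruct (Req_EM_T a 0); [lra | reflexivity]. }
  assert (J_smooth : forall a x, 0 < a < / omega ->
      dae_graph (J a x) (rscal (/ a) (minus (J a x) x))).
  { intros a x Ha; rewrite !J_pos by lra.
    exact (dae_graph_scal (RtoC (/ a)) _ _ (resolvent_graph _ _ (HS a Ha) x)). }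
  exists (/ omega), J; constructor; auto using dae_graph_plus.
  - apply Rinv_0_lt_compat, Pomega.
  - intros a Ha; destruct (Req_dec a 0) as [->|Ha0].
    { split; intros; rewrite !J_0; reflexivity. }
    assert (La := proj1 (HS a ltac:(lra))).
    split; intros; rewrite !J_pos by lra.
    + rewrite (linear_plus E E_linear), (linear_plus _ La); vector; exact Ha0.
    + rewrite (linear_rscal E _ _ E_linear), (linear_rscal _ _ _ La).
      vector; exact Ha0.
  - intros a x Ha; destruct (Req_dec a 0) as [->|Ha0]; [rewrite J_0; apply Rle_refl|].
    (* With [u = J a x], dissipativity says [energy_form (u - x) u <= 0], so
       [N u ^ 2 <= N x * N u]. *)
    assert (D := dae_graph_dissipative _ _ (J_smooth a x ltac:(lra))).
    set (u := J a x) in *.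
    replace (minus u x) with (plus u (rscal (-1) x)) in D by vector.
    rewrite energy_form_rscal, energy_form_plus, energy_form_rscal,
      <- energy_norm_sq in D.
    assert (Pa : 0 < / a) by (apply Rinv_0_lt_compat; lra).
    pose proof (energy_form_le x u); pose proof (energy_norm_pos u).
    pose proof (energy_norm_pos x).
    assert (energy_norm u ^ 2 + -1 * energy_form x u <= 0) by nra.
    nra.
  - intros c x g; exact (dae_graph_scal (RtoC c) x g).
  - intros a x g Ha Hx; destruct (Req_dec a 0) as [->|Ha0].
    + rewrite J_0; vector.
    + rewrite J_pos by lra.
      assert (La := proj1 (HS a ltac:(lra))).
      rewrite <- (linear_rscal _ _ _ La), <- (linear_rscal E _ _ E_linear).
      replace (rscal (/ a) (minus x (rscal a g)))
        with (minus (scal (RtoC (/ a)) x) g) by (vector; exact Ha0).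
      rewrite (linear_minus E _ _ E_linear), (linear_scal E E_linear).
      exact (resolvent_of_graph _ _ (HS a ltac:(lra)) _ _ Hx).
Qed.

(* [v] and [w] are the limits of [E] along the Euler approximations of the
   orbits of [x] and [g], so [w] is the derivative of [v]. *)
Lemma dae_orbit x g h :
  (exists omega : R, 0 < omega /\
     forall lambda : C, omega < Re lambda ->
       resolvent_set E (comp_op A Q) lambda) ->
  dae_graph x g -> dae_graph g h ->
  exists (v w : R -> Z) (L : R),
    v 0 = E x /\ w 0 = E g /\
    (forall s t, 0 <= s -> 0 <= t -> norm (minus (v s) (v t)) <= L * Rabs (s - t)) /\
    (forall s t, 0 <= s -> 0 <= t -> norm (minus (w s) (w t)) <= L * Rabs (s - t)) /\
    (forall s t, 0 <= s -> 0 <= t ->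
       norm (minus (minus (v s) (v t)) (rscal (s - t) (w t))) <= L * (s - t) ^ 2) /\
    (forall t, 0 <= t -> exists y z : nat -> X,
       eventually (fun k => dae_graph (y k) (z k)) /\
       filterlim (fun k => E (y k)) eventually (locally (v t)) /\
       filterlim (fun k => E (z k)) eventually (locally (w t))).
Proof.
  intros Hres Hx Hg.
  destruct (dae_step_operators Hres)
    as (r & J & HJ).
  destruct energy_norm_controls_E as (K & PK & HK).
  assert (HN := energy_norm_seminorm).
  set (U := fun k t => euler X J k t).
  assert (Lim : forall y g', dae_graph y g' -> exists v : R -> Z, forall t, 0 <= t ->
    filterlim (fun k => E (U k t y)) eventually (locally (v t))).
  { intros y g' Hy.
    exists (fun t => epsilon (inhabits (zero : Z))
      (fun v => filterlim (fun k => E (U k t y)) eventually (locally v))).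
    intros t Ht; apply epsilon_spec.
    exact (euler_converges _ _ HN _ _ _ HJ _ _ _ E_linear HK PK _ _ _ Ht Hy). }
  destruct (Lim x g Hx) as (v & Hv); destruct (Lim g h Hg) as (w & Hw).
  assert (At0 : forall y l, filterlim (fun k => E (U k 0 y)) eventually (locally l) ->
    l = E y).
  { intros y l Hl.
    apply (filterlim_locally_unique (V := Z) (F := eventually) _ _ _ Hl).
    apply filterlim_ext with (fun _ => E y); [|apply filterlim_const].
    intro k; unfold U; rewrite (euler_zero _ _ _ _ _ HJ); reflexivity. }
  assert (Pg := energy_norm_pos g); assert (Ph := energy_norm_pos h).
  (* The bounds involve [K N g] for [v] and [K N h] for [w] and the remainder; their sum serves as a
     common [L]. *)
  assert (Le : forall a c, 0 <= c -> (a = energy_norm g \/ a = energy_norm h) ->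
    K * a * c <= K * (energy_norm g + energy_norm h) * c).
  { intros a c Hc Ha; apply Rmult_le_compat_r; [exact Hc|].
    apply Rmult_le_compat_l; [exact PK|]; destruct Ha; lra. }
  exists v, w, (K * (energy_norm g + energy_norm h)).
  split; [exact (At0 x _ (Hv 0 (Rle_refl 0)))|].
  split; [exact (At0 g _ (Hw 0 (Rle_refl 0)))|].
  split; [|split; [|split]].
  - intros s t Hs Ht; apply Rle_trans with (2 := Le _ _ (Rabs_pos _) (or_introl eq_refl)).
    exact (euler_limit_lipschitz _ _ HN _ _ _ HJ _ _ _ E_linear HK PK _ _ _ _ _ _
      Hs Ht Hx (Hv s Hs) (Hv t Ht)).
  - intros s t Hs Ht; apply Rle_trans with (2 := Le _ _ (Rabs_pos _) (or_intror eq_refl)).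
    exact (euler_limit_lipschitz _ _ HN _ _ _ HJ _ _ _ E_linear HK PK _ _ _ _ _ _
      Hs Ht Hg (Hw s Hs) (Hw t Ht)).
  - intros s t Hs Ht; apply Rle_trans with (2 := Le _ _ (pow2_ge_0 _) (or_intror eq_refl)).
    exact (euler_limit_taylor _ _ HN _ _ _ HJ _ _ _ E_linear HK PK _ _ _ _ _ _ _ _
      Hs Ht Hx Hg (Hv s Hs) (Hv t Ht) (Hw t Ht)).
  - intros t Ht; exists (fun k => U k t x), (fun k => U k t g).
    split; [|split; [exact (Hv t Ht) | exact (Hw t Ht)]].
    destruct (eventually_small_step t r (family_range HJ)) as [k0 Hk0].
    exists k0; intros k Hk.
    exact (graph_euler _ _ _ _ _ HJ k t x g (step_range _ k0 t Ht Hk0 k Hk) Hx).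
Qed.

Lemma classical_solution_exists mu S y :
  (exists omega : R, 0 < omega /\
     forall lambda : C, omega < Re lambda ->
       resolvent_set E (comp_op A Q) lambda) ->
  is_resolvent E (comp_op A Q) mu S ->
  exists x, classical_solution E (comp_op A Q) (S (E (S (E y)))) x.
Proof.
  intros Hres HS; assert (LS := proj1 HS).
  set (z := S (E y)); set (x0 := S (E z)).
  (* Both come from [resolvent_graph]: it relates [x0] to [g = mu x0 - z] and [z] to [mu z - y]; by
     linearity [g] is related to [h]. *)
  set (g := minus (scal mu x0) z).
  set (h := minus (scal mu g) (minus (scal mu z) y)).
  assert (Hx : dae_graph x0 g) by exact (resolvent_graph mu S HS z).
  assert (Hg : dae_graph g h).
  { apply dae_graph_minus; [apply dae_graph_scal, Hx|].
    exact (resolvent_graph mu S HS y). }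
  destruct (dae_orbit x0 g h Hres Hx Hg)
    as (v & w & L & v0 & w0 & Lv & Lw & Tv & Hlim).
  set (x := fun t => S (minus (scal mu (v t)) (w t))).
  (* The approximants satisfy [p k = S (mu E (p k) - E (q k))], whose right side tends to [x t]; so
     [E (p k)] tends both to [E (x t)] and to [v t]. *)
  assert (Ex : forall t, 0 <= t -> E (x t) = v t).
  { intros t Ht; destruct (Hlim t Ht) as (p & q & Gpq & Hp & Hq).
    apply (filterlim_locally_unique (V := Z) (F := eventually)
      (fun k => E (p k))); [|exact Hp].
    apply (filterlim_linear E p (x t) E_linear).
    apply filterlim_ext_loc with
      (fun k => S (minus (scal mu (E (p k))) (E (q k)))).
    - revert Gpq; apply filter_imp; intros k Gk.
      exact (resolvent_of_graph mu S HS _ _ Gk).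
    - unfold x; apply (filterlim_linear S); [exact LS|].
      apply (filterlim_minus (V := Z)); [apply (filterlim_scal_const (V := Z))|]; assumption. }
  assert (Ax : forall t, 0 <= t -> dom A (Q (x t)) /\ A (Q (x t)) = w t).
  { intros t Ht; exact (resolvent_solves mu S HS (v t) (w t) (Ex t Ht)). }
  assert (Cv : forall t, 0 <= t -> filterlim v (at_halfline t) (locally (v t))).
  { intros t Ht; apply halfline_lipschitz_continuous with L; auto. }
  assert (Cw : forall t, 0 <= t -> filterlim w (at_halfline t) (locally (w t))).
  { intros t Ht; apply halfline_lipschitz_continuous with L; auto. }
  assert (Dx : forall t, 0 <= t -> is_derive_halfline (fun s => E (x s)) t (w t)).
  { intros t Ht; apply halfline_derive_quadratic with L; [exact Ht|].
    intros s Hs; rewrite !Ex by assumption; auto. }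
  exists x; split; [|split; [|split; [|split]]].
  - intros t Ht; assert (PF := at_halfline_proper t Ht).
    apply (filterlim_linear S (fun s => minus (scal mu (v s)) (w s))); [exact LS|].
    apply (filterlim_minus (V := Z)); [|exact (Cw t Ht)].
    apply (filterlim_scal_const (V := Z)); exact (Cv t Ht).
  - exists w; split; intros t Ht.
    + apply halfline_derive_is_derive; [exact Ht | apply Dx, Rlt_le, Ht].
    + intros P HP; apply locally_of_halfline; [exact Ht|].
      exact (Cw t (Rlt_le _ _ Ht) P HP).
  - intros t Ht; exact (proj1 (Ax t Ht)).
  - unfold x; rewrite v0, w0; exact (resolvent_of_graph mu S HS _ _ Hx).
  - intros t Ht; cbn; rewrite (proj2 (Ax t Ht)); exact (Dx t Ht).
Qed.

(** Only [E d] is differentiable, not [d], so no product rule applies. With [delta = d s - d t] the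
    quadratic term [Re <E delta, Q delta>] is still [o(s - t)]: [E delta] is [O(s - t)] and
    [Q delta] tends to zero by continuity of [d]. *)
Lemma energy_decreases (d : R -> X) :
  (forall t, 0 <= t -> filterlim d (at_halfline t) (locally (d t))) ->
  (forall t, 0 <= t -> dom A (Q (d t))) ->
  (forall t, 0 <= t -> is_derive_halfline (fun s => E (d s)) t (A (Q (d t)))) ->
  forall t, 0 <= t -> energy_form (d t) (d t) <= energy_form (d 0) (d 0).
Proof.
  intros Cd Dd Ed t Ht.
  apply (halfline_nonincreasing (fun s => energy_form (d s) (d s))
    (fun s => 2 * Re (inner (A (Q (d s))) (Q (d s))))); [| |exact Ht].
  2:{ intros s Hs; pose proof (pH_A_dissipative pH (Dd s Hs)); lra. }
  clear t Ht; intros t eps Ht Heps.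
  destruct (linear_norm Q Q_linear) as (M & PM & HM).
  set (c := norm (Q (d t))); set (a := norm (A (Q (d t)))).
  assert (Pc : 0 <= c) by apply norm_ge_0; assert (Pa : 0 <= a) by apply norm_ge_0.
  (* [e1] bounds the relative remainder [rho]: at most [1], for the Lipschitz constant [1 + a] of
     [E d], and small against [c]. [e2] is fixed by [(1 + a) * M * e2 = eps / 2]. Each of the two
     terms then takes half of [eps]. *)
  set (e1 := Rmin 1 (eps / (4 * (c + 1)))).
  set (e2 := eps / (2 * (1 + a) * M)).
  assert (Pe1 : 0 < e1).
  { apply Rmin_case; [lra | apply Rdiv_lt_0_compat; lra]. }
  assert (Pe2 : 0 < e2) by (apply Rdiv_lt_0_compat; nra).
  assert (e1_1 : e1 <= 1) by apply Rmin_l.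
  assert (e1_c : 2 * (e1 * c) <= eps / 2).
  { assert (e1 * (c + 1) <= eps / 4); [|nra].
    replace (eps / 4) with (eps / (4 * (c + 1)) * (c + 1)) by (field; lra).
    apply Rmult_le_compat_r; [lra | apply Rmin_r]. }
  assert (PF := at_halfline_proper t Ht).
  assert (Near := proj1 (filterlim_locally_ball_norm (K := C_AbsRing) d (d t))
    (Cd t Ht) (mkposreal e2 Pe2)).
  generalize (filter_and _ _ Near (halfline_derive_bound Z _ _ t e1 Pe1 (Ed t Ht))).
  apply filter_imp; intros s [Hn Hb].
  set (delta := minus (d s) (d t)).
  set (rho := minus (minus (E (d s)) (E (d t))) (rscal (s - t) (A (Q (d t))))) in Hb.
  change (norm delta < e2) in Hn.
  assert (Eq : energy_form (d s) (d s) - energy_form (d t) (d t)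
    - (s - t) * (2 * Re (inner (A (Q (d t))) (Q (d t))))
    = 2 * Re (inner rho (Q (d t))) + Re (inner (E delta) (Q delta))).
  { assert (R1 : Re (inner rho (Q (d t))) = energy_form delta (d t)
      - (s - t) * Re (inner (A (Q (d t))) (Q (d t)))).
    { unfold rho, delta, energy_form.
      rewrite (linear_minus E _ _ E_linear), !inner_minus_l, inner_rscal_l.
      unfold Re; cbn; ring. }
    assert (R2 : energy_form (d s) (d s) = energy_form (d t) (d t)
      + 2 * energy_form delta (d t) + energy_form delta delta).
    { replace (d s) with (plus (d t) delta) by (unfold delta; vector).
      rewrite energy_form_plus, (energy_form_sym (d t)), (energy_form_sym delta).
      rewrite !energy_form_plus, (energy_form_sym (d t) delta); ring. }
    rewrite R1, R2; unfold energy_form; ring. }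
  rewrite Eq.
  set (T := Rabs (s - t)) in *.
  assert (PT : 0 <= T) by apply Rabs_pos.
  assert (Edelta : norm (E delta) <= (1 + a) * T).
  { assert (Es : E delta = minus rho (rscal (- (s - t)) (A (Q (d t)))))
      by (unfold delta, rho; rewrite (linear_minus E _ _ E_linear); vector).
    rewrite Es.
    apply Rle_trans with (1 := norm_minus_le (V := Z) rho _).
    apply Rle_trans with (e1 * T + T * a); [|nra].
    apply Rplus_le_compat; [exact Hb|].
    refine (Rle_trans _ _ _ (norm_rscal _ _) _); apply Req_le.
    change (Rabs (- (s - t)) * a = T * a); rewrite Rabs_Ropp; reflexivity. }
  assert (Qdelta : norm (Q delta) <= M * e2).
  { apply Rle_trans with (1 := HM delta).
    apply Rmult_le_compat_l; [lra | apply Rlt_le, Hn]. }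
  assert (B1 : Rabs (Re (inner rho (Q (d t)))) <= e1 * c * T).
  { apply Rle_trans with (1 := Rabs_Re_inner_le _ _ _); fold c.
    replace (e1 * c * T) with (e1 * T * c) by ring.
    apply Rmult_le_compat_r; [exact Pc | exact Hb]. }
  assert (B2 : Rabs (Re (inner (E delta) (Q delta))) <= eps / 2 * T).
  { apply Rle_trans with (1 := Rabs_Re_inner_le _ _ _).
    apply Rle_trans with ((1 + a) * T * (M * e2)).
    - apply Rmult_le_compat; auto; apply norm_ge_0.
    - apply Req_le; unfold e2; field; lra. }
  apply Rle_trans with (1 := Rabs_triang _ _).
  rewrite Rabs_mult, (Rabs_pos_eq 2) by lra; nra.
Qed.

Lemma classical_solution_unique mu S x0 x x' :
  is_resolvent E (comp_op A Q) mu S ->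
  classical_solution E (comp_op A Q) x0 x ->
  classical_solution E (comp_op A Q) x0 x' ->
  forall t, 0 <= t -> x' t = x t.
Proof.
  intros HS (Cx & _ & Dx & x_0 & Ex) (Cx' & _ & Dx' & x'_0 & Ex').
  cbn in *.
  set (d := fun t => minus (x' t) (x t)).
  assert (AQd : forall t, 0 <= t -> dom A (Q (d t)) /\
      A (Q (d t)) = minus (A (Q (x' t))) (A (Q (x t)))).
  { intros t Ht; apply dom_AQ_minus; auto. }
  assert (Cd : forall t, 0 <= t -> filterlim d (at_halfline t) (locally (d t))).
  { intros t Ht; assert (PF := at_halfline_proper t Ht).
    apply (filterlim_minus (V := X)); [exact (Cx' t Ht) | exact (Cx t Ht)]. }
  assert (Ed : forall t, 0 <= t ->
      is_derive_halfline (fun s => E (d s)) t (A (Q (d t)))).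
  { intros t Ht; rewrite (proj2 (AQd t Ht)).
    assert (FF : Filter (within (fun s => 0 <= s) (locally t)))
      by apply within_filter, locally_filter.
    refine (@filterdiff_ext R_AbsRing R_NormedModule (real_NormedModule Z) _ FF
      _ _ _ _ (halfline_derive_minus Z _ _ _ _ t (Ex' t Ht) (Ex t Ht))).
    intro s; symmetry; exact (linear_minus E _ _ E_linear). }
  assert (Dd : forall t, 0 <= t -> dom A (Q (d t))).
  { intros t Ht; exact (proj1 (AQd t Ht)). }
  assert (E0 : forall t, 0 <= t -> E (d t) = zero).
  { intros t Ht.
    pose proof (energy_decreases d Cd Dd Ed t Ht) as De.
    assert (d0 : d 0 = rscal 0 x0) by (unfold d; rewrite x_0, x'_0; vector).
    rewrite d0, energy_form_rscal in De.
    assert (N0 : energy_norm (d t) = 0).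
    { pose proof (energy_norm_sq (d t)); pose proof (energy_norm_pos (d t)); nra. }
    destruct energy_norm_controls_E as (K & _ & HK).
    specialize (HK (d t)); rewrite N0 in HK.
    apply (norm_eq_zero (V := Z)); apply Rle_antisym; [|apply norm_ge_0].
    rewrite Rmult_0_r in HK; exact HK. }
  intros t Ht.
  assert (A0 := halfline_derive_zero Z _ _ t Ht E0 (Ed t Ht)).
  (* Both [E (d t)] and [A Q (d t)] vanish, so [d t] is killed by [mu E - A Q], which is injective
     by the resolvent. *)
  assert (dt0 : d t = rscal 0 (x t)).
  { rewrite <- (resolvent_of_graph mu S HS (d t) (rscal 0 (x t))).
    - assert (Ez : minus (scal mu (E (d t))) (E (rscal 0 (x t))) = rscal 0 (E (x t)))
        by (rewrite (E0 t Ht), (linear_rscal E _ _ E_linear); vector).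
      rewrite Ez, (linear_rscal _ _ _ (proj1 HS)); vector.
    - split; [exact (Dd t Ht)|].
      rewrite A0, (linear_rscal E _ _ E_linear); vector. }
  replace (x' t) with (plus (d t) (x t)) by (unfold d; vector).
  rewrite dt0; vector.
Qed.

End PortHamiltonian.

Theorem proposition5p2 :
  forall (X Z : HilbertSpace) (E : X -> Z) (A : partial_op Z Z) (Q : X -> Z),
  pH_DAE E A Q ->
  (exists omega : R, 0 < omega /\
     forall lambda : C, omega < Re lambda ->
       resolvent_set E (comp_op A Q) lambda) ->
  forall p : nat, is_complex_resolvent_index E (comp_op A Q) p ->
  forall (mu : C) (Rmu : Z -> X), is_resolvent E (comp_op A Q) mu Rmu ->
  forall x0 : X,
  (exists y : X, x0 = Nat.iter (p + 2) (fun x => Rmu (E x)) y) ->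
  exists x : R -> X,
    classical_solution E (comp_op A Q) x0 x /\
    forall x' : R -> X, classical_solution E (comp_op A Q) x0 x' ->
      forall t : R, 0 <= t -> x' t = x t.
Proof.
  intros X Z E A Q HpH Hres p _ mu Rmu Hmu x0 [y Hy].
  (* Written as [2 + p], the iterate exposes its two outermost factors, which supply [g] and [h];
     the inner iterate becomes the vector they act on. *)
  rewrite Nat.add_comm in Hy; cbn in Hy.
  destruct (classical_solution_exists X Z E A Q HpH mu Rmu
    (Nat.iter p (fun x => Rmu (E x)) y) Hres Hmu) as [x Hx].
  rewrite Hy; exists x; split; [exact Hx|].
  intros x' Hx'.
  exact (classical_solution_unique X Z E A Q HpH mu Rmu _ x x' Hmu Hx Hx').
Qed.
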